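(* Let $0<q<1$, let $\epsilon_i\in\{1,-1\}$ and $\mu_i>0$ for $i=1,2,3$, and let $W=W^{(\epsilon_1,\mu_1)}\otimes W^{(\epsilon_2,\mu_2)}\otimes W^{(\epsilon_3,\mu_3)}$ be the three-fold tensor product of $\mathfrak{osp}_q(1|2)$-modules. Define operators on $W$ by $$I_1=-Q^{(23)},\qquad I_3=-Q^{(12)},$$ $$I_2=\{I_3,I_1\}_q-(q^{1/2}+q^{-1/2})\left[Q^{(3)}Q^{(1)}+Q^{(2)}\mathcal{Q}\right].$$ Then for every even permutation $(ijk)$ of $\{1,2,3\}$, $$\{I_i,I_j\}_q=I_k+(q^{1/2}+q^{-1/2})\left[Q^{(i)}Q^{(j)}+Q^{(k)}\mathcal{Q}\right].$$ Consequently, on the eigenspace of $\mathcal{Q}$ in $W$ with eigenvalue $\tau$, one has $$\{I_i,I_j\}_q=I_k+\iota_k,\qquad \iota_k=(q^{1/2}+q^{-1/2})(\tau\tau_k+\tau_i\tau_j),$$ for every even permutation $(ijk)$ of $\{1,2,3\}$, where $\tau_i=-\epsilon_i[\mu_i]_q$.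
   Context: Notation: $[x]_q=\frac{q^x-q^{-x}}{q-q^{-1}}$, $[x,y]=xy-yx$, $\{x,y\}=xy+yx$, and $\{A,B\}_q=q^{1/2}AB+q^{-1/2}BA$. The algebra $\mathfrak{osp}_q(1|2)$ (extended by its grade involution) has generators $A_0,A_+,A_-,P$, with $P^2=1$ and, writing $K=q^{A_0/2}$, $K^{-1}=q^{-A_0/2}$, $$[A_0,P]=0,\quad \{A_\pm,P\}=0,\quad [A_0,A_\pm]=\pm A_\pm,\quad \{A_+,A_-\}=\frac{K^2-K^{-2}}{q^{1/2}-q^{-1/2}}.$$ Its Casimir operator, which commutes with all generators, is $$Q=\left[A_+A_--\frac{q^{-1/2}K^2-q^{1/2}K^{-2}}{q-q^{-1}}\right]P.$$ The (coassociative) coproduct is the algebra homomorphism determined by $$\Delta(A_\pm)=A_\pm\otimes KP+K^{-1}\otimes A_\pm,\quad \Delta(K^{\pm1})=K^{\pm1}\otimes K^{\pm1},\quad \Delta(P)=P\otimes P,$$ so that $\Delta(A_0)=A_0\otimes 1+1\otimes A_0$. The ordinary (ungraded) product rule $(a\otimes b)(c\otimes d)=ac\otimes bd$ is used. For $\epsilon=\pm1$ and $\mu>0$, $W^{(\epsilon,\mu)}$ is the vector space with orthonormal basis $|\epsilon,\mu;n\rangle$, $n=0,1,2,\ldots$, and actions $$A_0|\epsilon,\mu;n\rangle=(n+\mu+\tfrac12)|\epsilon,\mu;n\rangle,\quad P|\epsilon,\mu;n\rangle=\epsilon(-1)^n|\epsilon,\mu;n\rangle,$$ $$A_+|\epsilon,\mu;n\rangle=\sqrt{\sigma_{n+1}}\,|\epsilon,\mu;n+1\rangle,\quad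 A_-|\epsilon,\mu;n\rangle=\sqrt{\sigma_n}\,|\epsilon,\mu;n-1\rangle,$$ with $\sigma_n=[n+\mu]_q-(-1)^n[\mu]_q$. On $W^{(\epsilon,\mu)}$ the Casimir $Q$ acts as $-\epsilon[\mu]_q$ times the identity. Initial, intermediate and total Casimir operators on $W$: $Q^{(1)}=Q\otimes1\otimes1$, $Q^{(2)}=1\otimes Q\otimes1$, $Q^{(3)}=1\otimes1\otimes Q$; $Q^{(12)}=\Delta(Q)\otimes1$, $Q^{(23)}=1\otimes\Delta(Q)$; $\mathcal{Q}=(1\otimes\Delta)\Delta(Q)=(\Delta\otimes1)\Delta(Q)$. Each $Q^{(i)}$ acts on $W$ as $\tau_i=-\epsilon_i[\mu_i]_q$ times the identity. *)

(* Defs.v *)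
From HB Require Import structures.
From mathcomp Require Import all_boot all_order all_algebra all_fingroup.
From mathcomp Require Import functions reals exp.
From mathcomp Require Import finmap complex ring.
From mathcomp.multinomials Require Import monalg.
Set Implicit Arguments.
Unset Strict Implicit.
Unset Printing Implicit Defensive.
Import Order.TTheory GRing.Theory Num.Theory.
Local Open Scope ring_scope.
Local Open Scope complex_scope.

(** Vector spaces are over [R[i]] with [R : realType].  [{malg R[i][B]}] is the
    space of finite linear combinations of a basis indexed by [B], with [<< b >>]
    the basis vector of index [b].  Operators are functions [V -> V]: [+], [-]
    and [*:] on them are pointwise, the product is [\o]. *)

Definition qpow (R : realType) (q x : R) : R[i] := (q `^ x)%:C.

Definition qnum (R : realType) (q x : R) : R :=
  (q `^ x - q `^ (- x)) / (q - q^-1).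

Definition acomm (V : zmodType) (f g : V -> V) : V -> V := (f \o g) + (g \o f).

Definition comm (V : zmodType) (f g : V -> V) : V -> V := (f \o g) - (g \o f).

Definition qacomm (R : realType) (q : R) (V : lmodType R[i]) (f g : V -> V) :
    V -> V :=
  qpow q 2^-1 *: (f \o g) + qpow q (- 2^-1) *: (g \o f).

(** Images in [End V] of the generators of osp_q(1|2), together with those of
    [K = q^(A0/2)] and [K^-1].  An algebra homomorphism from osp_q(1|2) to
    [End V] is such a tuple satisfying [osp_relations]. *)
Record osp_ops (V : Type) := OspOps {
  opA0 : V -> V;
  opAp : V -> V;
  opAm : V -> V;
  opK  : V -> V;
  opKi : V -> V;
  opP  : V -> V
}.

Definition osp_map (V W : Type) (h : (V -> V) -> (W -> W)) (X : osp_ops V) :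
    osp_ops W :=
  OspOps (h (opA0 X)) (h (opAp X)) (h (opAm X)) (h (opK X)) (h (opKi X))
         (h (opP X)).

(** [K_exp] says that [K] and [K^-1] are the exponentials [q^(A0/2)] and
    [q^(-A0/2)], on the eigenvectors of [A0]. *)
Record osp_relations (R : realType) (q : R) (V : lmodType R[i])
    (X : osp_ops V) : Prop := OspRelations {
  A0_linear : linear (opA0 X);
  Ap_linear : linear (opAp X);
  Am_linear : linear (opAm X);
  K_linear  : linear (opK X);
  Ki_linear : linear (opKi X);
  P_linear  : linear (opP X);
  K_exp : forall (a : R) (v : V), opA0 X v = a%:C *: v ->
    opK X v = qpow q (a / 2) *: v /\ opKi X v = qpow q (- a / 2) *: v;
  P_invol   : opP X \o opP X = id;
  A0_P_comm : comm (opA0 X) (opP X) = 0;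
  Ap_P_acomm : acomm (opAp X) (opP X) = 0;
  Am_P_acomm : acomm (opAm X) (opP X) = 0;
  A0_Ap_comm : comm (opA0 X) (opAp X) = opAp X;
  A0_Am_comm : comm (opA0 X) (opAm X) = - opAm X;
  Ap_Am_acomm : acomm (opAp X) (opAm X) =
    ((q `^ 2^-1 - q `^ (- 2^-1))^-1)%:C *:
      ((opK X \o opK X) - (opKi X \o opKi X))
}.

Definition casimir (R : realType) (q : R) (V : lmodType R[i]) (X : osp_ops V) :
    V -> V :=
  ((opAp X \o opAm X)
     - ((q - q^-1)^-1)%:C *: (qpow q (- 2^-1) *: (opK X \o opK X)
                               - qpow q 2^-1 *: (opKi X \o opKi X)))
  \o opP X.

(** If [X] and [Y] represent homomorphisms [phi] and [psi] from osp_q(1|2) to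
    [End V] with commuting images, [comul X Y] represents the homomorphism
    [(phi . psi) o Delta], where [phi . psi] maps [a (x) b] to
    [phi a \o psi b]. *)
Definition comul (V : zmodType) (X Y : osp_ops V) : osp_ops V :=
  OspOps (opA0 X + opA0 Y)
         ((opAp X \o (opK Y \o opP Y)) + (opKi X \o opAp Y))
         ((opAm X \o (opK Y \o opP Y)) + (opKi X \o opAm Y))
         (opK X \o opK Y)
         (opKi X \o opKi Y)
         (opP X \o opP Y).

(** The linear map sending [<< b >>] to [f b]. *)
Definition linext (K : nzRingType) (B : choiceType) (V : lmodType K)
    (f : B -> V) (v : {malg K[B]}) : V :=
  \sum_(b <- msupp v) v@_b *: f b.

Lemma linextEw (K : nzRingType) (B : choiceType) (V : lmodType K)
    (f : B -> V) (v : {malg K[B]}) (d : {fset B}) :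
  (msupp v `<=` d)%fset -> linext f v = \sum_(b <- d) v@_b *: f b.
Proof.
move=> sub; rewrite /linext (big_fset_incl _ sub) // => b _ nb.
by rewrite mcoeff_outdom // scale0r.
Qed.

Lemma linext_linear (K : nzRingType) (B : choiceType) (V : lmodType K)
    (f : B -> V) : linear (linext f).
Proof.
move=> a u v; set d := (msupp (a *: u + v) `|` (msupp u `|` msupp v))%fset.
have [s0 s1 s2] : [/\ msupp (a *: u + v) `<=` d, msupp u `<=` d
    & msupp v `<=` d]%fset.
  by split; apply/fsubsetP => x xs; rewrite !in_fsetU xs ?orbT.
rewrite (linextEw f s0) (linextEw f s1) (linextEw f s2) scaler_sumr -big_split.
by apply: eq_bigr => b _; rewrite mcoeffD mcoeffZ scalerDl scalerA.
Qed.

Lemma linextU (K : nzRingType) (B : choiceType) (V : lmodType K)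
    (f : B -> V) (b : B) : linext f << b >> = f b.
Proof. by rewrite /linext msuppU oner_eq0 big_seq_fset1 mcoeffUU scale1r. Qed.

Lemma linext0 (K : nzRingType) (B : choiceType) (V : lmodType K)
    (f : B -> V) : linext f 0 = 0.
Proof. by rewrite /linext msupp0 big_seq_fset0. Qed.

Lemma linextD (K : nzRingType) (B : choiceType) (V : lmodType K)
    (f : B -> V) : {morph linext f : u v / u + v}.
Proof. by move=> u v; have := linext_linear f 1 u v; rewrite !scale1r. Qed.

Lemma linextZ (K : nzRingType) (B : choiceType) (V : lmodType K)
    (f : B -> V) (a : K) (v : {malg K[B]}) : linext f (a *: v) = a *: linext f v.
Proof.
by have := linext_linear f a v 0; rewrite linext0 !addr0.
Qed.

Lemma linext_id (K : nzRingType) (B : choiceType) (v : {malg K[B]}) :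
  linext (fun b => << b >>) v = v.
Proof.
rewrite [RHS]monalgE; apply: eq_bigr => b _.
by apply/malgP => k; rewrite mcoeffZ !mcoeffU mulrnAr mulr1.
Qed.

Lemma linext_cancel (K : nzRingType) (B : choiceType) (c : B -> K)
    (a : K) (v : {malg K[B]}) :
  linext (fun b => c b *: << b >>) v = a *: v ->
  forall b, b \in msupp v -> v@_b * c b = a * v@_b.
Proof.
move=> E b bv; rewrite -[RHS]mcoeffZ -E /linext raddf_sum /=.
rewrite (big_fsetD1 b) //= big1_fset ?addr0; last first.
  move=> k; rewrite !inE => /andP [/negPf kb _] _.
  by rewrite !mcoeffZ mcoeffU kb mulr0n !mulr0.
by rewrite !mcoeffZ mcoeffUU mulr1.
Qed.

Lemma q_subV_lt0 (R : realType) (q : R) : 0 < q -> q < 1 -> q - q^-1 < 0.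
Proof. by move=> q0 q1; rewrite subr_lt0 (lt_trans q1) // invf_gt1. Qed.

Lemma linext_const (K : nzRingType) (B : choiceType) (c : B -> K)
    (a : K) (v : {malg K[B]}) :
  (forall b, b \in msupp v -> c b = a) -> (forall x, a * x = x * a) ->
  linext (fun b => c b *: << b >>) v = a *: v.
Proof.
move=> ca aC; rewrite [in RHS](monalgE v) scaler_sumr /linext.
apply: eq_big_seq => b bv; rewrite ca //.
by apply/malgP => k; rewrite !mcoeffZ !mcoeffU mulrA -aC -mulrA mulrnAr mulr1.
Qed.

Definition sigma (R : realType) (q mu : R) (n : nat) : R :=
  qnum q (n%:R + mu) - (-1) ^+ n * qnum q mu.

(** The value of [opAm] at [<< 0 >>] is 0, because [sigma q mu 0 = 0]. *)
Definition irrep (R : realType) (q eps mu : R) : osp_ops {malg R[i][nat]} :=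
  let weight n : R := n%:R + mu + 2^-1 in
  OspOps
    (linext (fun n => (weight n)%:C *: << n >>))
    (linext (fun n => (Num.sqrt (sigma q mu n.+1))%:C *: << n.+1 >>))
    (linext (fun n => (Num.sqrt (sigma q mu n))%:C *: << n.-1 >>))
    (linext (fun n => qpow q (weight n / 2) *: << n >>))
    (linext (fun n => qpow q (- weight n / 2) *: << n >>))
    (linext (fun n => (eps * (-1) ^+ n)%:C *: << n >>)).

Lemma sigma0 (R : realType) (q mu : R) : sigma q mu 0 = 0.
Proof. by rewrite /sigma add0r mul1r subrr. Qed.

Lemma sigma_ge0 (R : realType) (q mu : R) (n : nat) :
  0 < q -> q < 1 -> 0 < mu -> 0 <= sigma q mu n.
Proof.
move=> q0 q1 mu0.
have qq := q_subV_lt0 q0 q1.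
have qnum_le x y : x <= y -> qnum q x <= qnum q y.
  move=> xy; rewrite /qnum ler_ndivrMr // mulfVK ?lt_eqF //.
  have qd a b : a <= b -> q `^ b <= q `^ a.
    by move=> ab; apply: ger_powR => //; rewrite q0 ltW.
  by rewrite lerB // qd // lerN2.
have q_ge0 : 0 <= qnum q mu.
  by have := qnum_le 0 mu (ltW mu0); rewrite /qnum oppr0 subrr mul0r.
have h : qnum q mu <= qnum q (n%:R + mu) by apply: qnum_le; rewrite lerDr.
rewrite /sigma subr_ge0; apply: le_trans h.
rewrite -signr_odd; case: odd; rewrite ?expr0 ?expr1 ?mul1r // mulN1r.
by rewrite (le_trans _ q_ge0) // oppr_le0.
Qed.

Lemma sigma_sum (R : realType) (q mu : R) (n : nat) : 0 < q -> q < 1 ->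
  sigma q mu n.+1 + sigma q mu n =
  (q `^ (n%:R + mu + 2^-1) - q `^ (- (n%:R + mu + 2^-1)))
    / (q `^ 2^-1 - q `^ (- 2^-1)).
Proof.
move=> q0 q1.
have qD x y : q `^ (x + y) = q `^ x * q `^ y.
  by rewrite powRD // (gt_eqF q0) implybT.
have qq := q_subV_lt0 q0 q1.
set h := q `^ 2^-1; have h0 : 0 < h by rewrite powR_gt0.
have qE : q `^ 2^-1 * q `^ 2^-1 = q.
  by rewrite -qD (_ : 2^-1 + 2^-1 = 1) ?powRr1 ?ltW //; field.
have qnumE x : qnum q x = (q `^ x - (q `^ x)^-1) / (h * h - (h * h)^-1).
  by rewrite /qnum powRN [in RHS]qE.
have h1 : h * h < 1 by rewrite qE.
rewrite /sigma exprS !qnumE !powRN -natr1.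
rewrite !qD -/h (_ : q `^ 1 = h * h) ?powRr1 ?(ltW q0) //.
set a := q `^ n%:R; set b := q `^ mu.
have a0 : a != 0 by rewrite gt_eqF // powR_gt0.
have b0 : b != 0 by rewrite gt_eqF // powR_gt0.
have hn0 : h != 0 by rewrite gt_eqF.
have h21 : h ^+ 2 - 1 != 0 by rewrite subr_eq0 lt_eqF.
have h21' : h ^+ 2 + 1 != 0 by rewrite gt_eqF // ltr_wpDl // sqr_ge0.
field; rewrite ?a0 ?b0 ?hn0 ?h21 ?h21' //=.
by rewrite subr_eq0 lt_eqF // mulr_ilt1 ?mulr_ge0 ?(ltW h0).
Qed.

Section WeightedShift.
Context (K : comNzRingType) (B : choiceType).
Local Notation shift c h := (linext (fun n : B => (c n : K) *: << h n : B >>)).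
Implicit Types (c d : B -> K) (h k : B -> B).

Lemma shift_comp c h d k :
  (shift c h \o shift d k) = shift (fun n => d n * c (k n)) (fun n => h (k n)).
Proof.
apply: boolp.funext => v /=; rewrite [X in linext _ X = _]/linext.
rewrite (big_morph _ (linextD _) (linext0 _)); apply: eq_bigr => b _.
by rewrite !linextZ linextU !scalerA !mulrA.
Qed.

Lemma bin_shift (s : K) c h d k e m :
  (forall n, (d n * c (k n)) *: << h (k n) >>
     + s *: ((c n * d (h n)) *: << k (h n) >>) = e n *: << m n >> :> {malg K[B]}) ->
  (shift c h \o shift d k) + s *: (shift d k \o shift c h) = shift e m.
Proof.
move=> E; rewrite !shift_comp; apply: boolp.funext => v.
set f := linext _; set g := linext _.
rewrite -[LHS]/(f v + s *: g v) /f /g /linext scaler_sumr -big_split /=.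
apply: eq_bigr => x _; rewrite -E scalerDr; congr (_ + _).
by rewrite !scalerA !mulrA (mulrC s).
Qed.

Lemma comm_shift c h d k e m :
  (forall n, (d n * c (k n)) *: << h (k n) >>
     - (c n * d (h n)) *: << k (h n) >> = e n *: << m n >> :> {malg K[B]}) ->
  comm (shift c h) (shift d k) = shift e m.
Proof. by move=> E; rewrite /comm -scaleN1r; apply: bin_shift => // n; rewrite scaleN1r. Qed.

Lemma acomm_shift c h d k e m :
  (forall n, (d n * c (k n)) *: << h (k n) >>
     + (c n * d (h n)) *: << k (h n) >> = e n *: << m n >> :> {malg K[B]}) ->
  acomm (shift c h) (shift d k) = shift e m.
Proof.
by move=> E; rewrite /acomm -[X in _ + X]scale1r; apply: bin_shift => // n; rewrite scale1r.
Qed.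

Lemma shift_opp c h : - shift c h = shift (fun n => - c n) h.
Proof.
apply: boolp.funext => v; rewrite -[LHS]/(- shift c h v) /linext -sumrN.
by apply: eq_bigr => b _; rewrite scaleNr scalerN.
Qed.

Lemma shift_eq0 : 0 = shift (fun=> 0) id.
Proof.
apply: boolp.funext => v; rewrite -[LHS]/(0 : {malg K[B]}) /linext.
by symmetry; apply: big1 => b _; rewrite scale0r scaler0.
Qed.

Lemma shift_sqB a c d :
  a *: ((shift c id \o shift c id) - (shift d id \o shift d id)) =
  shift (fun n => a * (c n * c n - d n * d n)) id.
Proof.
rewrite !shift_comp; apply: boolp.funext => v.
set f := linext _; set g := linext _.
rewrite -[LHS]/(a *: (f v - g v)) /f /g /linext -sumrB scaler_sumr /=.
apply: eq_bigr => x _.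
by rewrite -scalerBr -scalerBl !scalerA mulrA (mulrC a) -mulrA.
Qed.

Lemma sq_shift c : (forall n, c n * c n = 1) -> shift c id \o shift c id = id.
Proof.
move=> c1; rewrite shift_comp; apply: boolp.funext => v.
rewrite -[RHS]linext_id; apply: eq_bigr => b _.
by rewrite c1 scale1r.
Qed.

End WeightedShift.

Lemma irrep_osp (R : realType) (q eps mu : R) :
  0 < q -> q < 1 -> eps = 1 \/ eps = -1 -> 0 < mu ->
  osp_relations q (irrep q eps mu).
Proof.
move=> q0 q1 he mu0.
have ee : eps * eps = 1 by case: he => ->; rewrite ?mulrNN mulr1.
have s0 n : 0 <= sigma q mu n by exact: sigma_ge0.
have qq a b : qpow q a * qpow q b = qpow q (a + b).
  by rewrite /qpow powRD ?(gt_eqF q0) ?implybT // rmorphM.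
split; try exact: linext_linear.
- move=> a v /= /linext_cancel h.
  have hw b : b \in msupp v -> b%:R + mu + 2^-1 = a.
    move=> bv; have := h b bv; rewrite mulrC => /mulIf.
    by rewrite mcoeff_neq0 => /(_ bv) [].
  split.
    apply: linext_const => [b bv|x]; last exact: mulrC.
    by rewrite (hw b bv).
  apply: linext_const => [b bv|x]; last exact: mulrC.
  by rewrite (hw b bv).
- apply: sq_shift => n.
  rewrite -rmorphM /= mulrACA ee mul1r -exprD addnn -mul2n exprM sqrrN.
  by rewrite !expr1n.
- rewrite [RHS]shift_eq0; apply: comm_shift => n.
  by rewrite [in X in X - _]mulrC subrr scale0r.
- rewrite [RHS]shift_eq0; apply: acomm_shift => n.
  rewrite -scalerDl scale0r -!rmorphM -rmorphD exprS.
  by rewrite (_ : _ + _ = 0 :> R) ?scale0r //; ring.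
- rewrite [RHS]shift_eq0; apply: acomm_shift => -[|n].
    by rewrite sigma0 sqrtr0 mulr0 mul0r !scale0r addr0.
  rewrite -scalerDl scale0r -!rmorphM -rmorphD exprS /=.
  by rewrite (_ : _ + _ = 0 :> R) ?scale0r //; ring.
- apply: comm_shift => n; rewrite -scalerBl -!rmorphM -rmorphB.
  by congr (_%:C *: _); rewrite -natr1; ring.
- rewrite [RHS]shift_opp; apply: comm_shift => -[|n].
    by rewrite sigma0 sqrtr0 mulr0 mul0r oppr0 !scale0r subrr.
  rewrite -scalerBl -!rmorphM -rmorphB -rmorphN.
  by congr (_%:C *: _); rewrite /= -natr1; ring.
- rewrite [RHS]shift_sqB; apply: acomm_shift => n.
  transitivity ((sigma q mu n.+1 + sigma q mu n)%:C *: << n >> : {malg R[i][nat]}).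
    case: n => [|n]; rewrite -!rmorphM.
      by rewrite sigma0 sqrtr0 mul0r scale0r add0r addr0 -expr2 sqr_sqrtr.
    by rewrite /= -!expr2 !sqr_sqrtr // -scalerDl -rmorphD addrC.
  congr (_ *: _); rewrite sigma_sum //.
  set w := n%:R + mu + 2^-1.
  rewrite (qq (w / 2)) (qq (- w / 2)) /qpow -rmorphB -rmorphM; congr (_%:C).
  by rewrite [LHS]mulrC -!splitr.
Qed.

(** The tensor product of the spaces with bases indexed by [A] and [B] is the
    space with basis indexed by [A * B]. *)
Definition tens (K : nzRingType) (A B : choiceType) (u : {malg K[A]})
    (v : {malg K[B]}) : {malg K[(A * B)%type]} :=
  linext (fun a => linext (fun b => << (a, b) >>) v) u.

Definition tmap (K : nzRingType) (A B : choiceType)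
    (f : {malg K[A]} -> {malg K[A]}) (g : {malg K[B]} -> {malg K[B]}) :
    {malg K[(A * B)%type]} -> {malg K[(A * B)%type]} :=
  linext (fun ab => tens (f << ab.1 >>) (g << ab.2 >>)).

Notation W3 R := {malg R[i][(nat * nat * nat)%type]}.

Definition ix1 : 'I_3 := @Ordinal 3 0 isT.
Definition ix2 : 'I_3 := @Ordinal 3 1 isT.
Definition ix3 : 'I_3 := @Ordinal 3 2 isT.

(** [f (x) 1 (x) 1], [1 (x) f (x) 1] and [1 (x) 1 (x) f]. *)
Definition slot (R : realType) (i : 'I_3)
    (f : {malg R[i][nat]} -> {malg R[i][nat]}) : W3 R -> W3 R :=
  match val i with
  | 0 => tmap (tmap f id) id
  | 1 => tmap (tmap id f) id
  | _ => tmap id f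
  end.

Definition factor (R : realType) (q : R) (eps mu : 'I_3 -> R) (i : 'I_3) :
    osp_ops (W3 R) :=
  osp_map (slot i) (irrep q (eps i) (mu i)).

Definition Qone (R : realType) (q : R) (eps mu : 'I_3 -> R) (i : 'I_3) :
    W3 R -> W3 R :=
  slot i (casimir q (irrep q (eps i) (mu i))).

Definition Q12 (R : realType) (q : R) (eps mu : 'I_3 -> R) : W3 R -> W3 R :=
  casimir q (comul (factor q eps mu ix1) (factor q eps mu ix2)).

Definition Q23 (R : realType) (q : R) (eps mu : 'I_3 -> R) : W3 R -> W3 R :=
  casimir q (comul (factor q eps mu ix2) (factor q eps mu ix3)).

(** [(1 (x) Delta) (Delta Q)]. *)
Definition Qtot (R : realType) (q : R) (eps mu : 'I_3 -> R) : W3 R -> W3 R :=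
  casimir q (comul (factor q eps mu ix1)
                   (comul (factor q eps mu ix2) (factor q eps mu ix3))).

Definition I1 (R : realType) (q : R) (eps mu : 'I_3 -> R) : W3 R -> W3 R :=
  - Q23 q eps mu.

Definition I3 (R : realType) (q : R) (eps mu : 'I_3 -> R) : W3 R -> W3 R :=
  - Q12 q eps mu.

Definition I2 (R : realType) (q : R) (eps mu : 'I_3 -> R) : W3 R -> W3 R :=
  qacomm q (I3 q eps mu) (I1 q eps mu)
  - (qpow q 2^-1 + qpow q (- 2^-1)) *:
      ((Qone q eps mu ix3 \o Qone q eps mu ix1)
       + (Qone q eps mu ix2 \o Qtot q eps mu)).

Definition Iop (R : realType) (q : R) (eps mu : 'I_3 -> R) (i : 'I_3) :
    W3 R -> W3 R :=
  match val i with
  | 0 => I1 q eps mu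
  | 1 => I2 q eps mu
  | _ => I3 q eps mu
  end.

Definition tau_ (R : realType) (q : R) (eps mu : 'I_3 -> R) (i : 'I_3) : R :=
  - eps i * qnum q (mu i).

(* Main.v *)
Require Import Defs.
From HB Require Import structures.
From mathcomp Require Import all_boot all_order all_algebra all_fingroup.
From mathcomp Require Import boolp functions reals exp.
From mathcomp Require Import finmap complex ring.
From mathcomp.multinomials Require Import monalg.
Set Implicit Arguments.
Unset Strict Implicit.
Unset Printing Implicit Defensive.
Import Order.TTheory GRing.Theory Num.Theory.
Local Open Scope ring_scope.
Local Open Scope complex_scope.

(** Let [h = q^(1/2)], [c = h + h^-1], [O = Q23] and [M = Q12].  Eliminating
    [I2], the relations for [{I1, I2}_q] and [{I2, I3}_q] say that
    [O^2 M + M O^2 + (q + q^-1) O M O] and [M^2 O + O M^2 + (q + q^-1) M O M]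
    are explicit combinations of [1], [O], [M], [Qtot], [O Qtot], [M Qtot].
    In the first one, expanding the coproduct writes [M] as a sum of terms
    [u X] where [u] lives on site 1 and [X] on site 2 is [Y = K^2 P], [1], or
    [[A+-, Y] K^-1 P].  As [A+-] and [K^-1 P] in the last ones may be replaced
    by their coproducts on sites 2 and 3, which commute with [O], everything
    follows from the identity for [X = Y].  That one holds on two sites because
    [O = D + T+ + T-] where [D] commutes with [Y], [T+] and [T-] q-commute with
    [Y], and [T- T+ - q^-2 T+ T-] is a polynomial in [K^-2 P] on the first site
    and [K^2 P] on the second one.
    The second relation is the mirror image, with [Y = K^-2 P]. *)

(** * Normal forms in noncommutative algebras *)

Inductive aexp (F : Type) :=
  | AVar of nat | AZero | AOne | AAdd of aexp F & aexp F | AOpp of aexp F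
  | AMul of aexp F & aexp F | AScale of F & aexp F.
Arguments AVar {F}.
Arguments AZero {F}.
Arguments AOne {F}.

(* A rewriting system: the leaf [RLeaf i j r] rewrites the product of the
   variables [i] and [j] to [r]. *)
Inductive rtree (T : Type) :=
  | RLeaf of nat & nat & T | RNode of rtree T & rtree T.

Section Normalization.
Context (F : nzRingType) (A : algType F).

(* The coefficient [None] stands for 1. *)
Definition cval (c : option F) : F := if c is Some a then a else 1.
Definition cmul (c d : option F) : option F :=
  match c, d with
  | None, _ => d
  | _, None => c
  | Some a, Some b => Some (a * b)
  end.

Definition ncpoly := seq (option F * seq nat).

(** A plain fixpoint with [if] and [eqn], so that the restricted [cbv] of [alg_coefs] decides it
    while the coefficients stay symbolic. *)
Fixpoint word_eq (u v : seq nat) : bool :=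
  match u, v with
  | [::], [::] => true
  | i :: u', j :: v' => if eqn i j then word_eq u' v' else false
  | _, _ => false
  end.

Fixpoint pinsert (c : option F) (w : seq nat) (p : ncpoly) : ncpoly :=
  match p with
  | [::] => [:: (c, w)]
  | (d, v) :: p' =>
      if word_eq w v then (Some (cval c + cval d), v) :: p'
      else (d, v) :: pinsert c w p'
  end.

Fixpoint paddscale (c : option F) (p q : ncpoly) : ncpoly :=
  match p with
  | [::] => q
  | (d, w) :: p' => pinsert (cmul c d) w (paddscale c p' q)
  end.

Fixpoint pbind (p : ncpoly) (f : seq nat -> ncpoly) : ncpoly :=
  match p with
  | [::] => [::]
  | (c, w) :: p' => paddscale c (f w) (pbind p' f)
  end.

Fixpoint rlookup (r : rtree ncpoly) (i j : nat) : option ncpoly :=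
  match r with
  | RLeaf i' j' p =>
      if eqn i i' then if eqn j j' then Some p else None else None
  | RNode r1 r2 =>
      match rlookup r1 i j with Some p => Some p | None => rlookup r2 i j end
  end.

Fixpoint pushw (f : nat -> seq nat -> ncpoly) (u w : seq nat) : ncpoly :=
  match u with
  | [::] => [:: (None, w)]
  | i :: u' => pbind (pushw f u' w) (f i)
  end.

(** Left multiplication of the word [w] by the letter [i]: when a rule applies to [i] and the head
    of [w], the letters of its right-hand side are pushed in turn. The number [k] bounds the depth
    of rewriting; once it is exhausted the word is left as it is, which does not change its
    value. *)
Fixpoint push (r : option (rtree ncpoly)) (k : nat) (i : nat) (w : seq nat) :
    ncpoly :=
  match r, k, w with
  | Some r0, k'.+1, j :: w' =>
      match rlookup r0 i j with
      | Some p => pbind p (fun u => pushw (push r k') u w')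
      | None => [:: (None, i :: w)]
      end
  | _, _, _ => [:: (None, i :: w)]
  end.

Fixpoint anorm (f : nat -> seq nat -> ncpoly) (e : aexp F) : ncpoly :=
  match e with
  | AVar n => [:: (None, [:: n])]
  | AZero => [::]
  | AOne => [:: (None, [::])]
  | AAdd a b => paddscale None (anorm f a) (anorm f b)
  | AOpp a => paddscale (Some (-1)) (anorm f a) [::]
  | AMul a b => pbind (anorm f a) (fun u => pbind (anorm f b) (pushw f u))
  | AScale c a => paddscale (Some c) (anorm f a) [::]
  end.

(** Right-hand sides are only expanded here, by the rule-free [push None 0]; they get rewritten when
    [push] uses them. *)
Fixpoint rcompile (r : rtree (aexp F)) : rtree ncpoly :=
  match r with
  | RLeaf i j e => RLeaf i j (anorm (push None 0) e)
  | RNode r1 r2 => RNode (rcompile r1) (rcompile r2)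
  end.

Fixpoint pvanish (p : ncpoly) : Prop :=
  match p with
  | [::] => True
  | (c, _) :: p' => cval c = 0 /\ pvanish p'
  end.

Definition reduced_diff (r : rtree (aexp F)) (s t : aexp F) : ncpoly :=
  let r' := rcompile r in anorm (push (Some r') 100) (AAdd s (AOpp t)).

Section Soundness.
Variable env : seq A.

Fixpoint aval (e : aexp F) : A :=
  match e with
  | AVar n => env`_n
  | AZero => 0
  | AOne => 1
  | AAdd a b => aval a + aval b
  | AOpp a => - aval a
  | AMul a b => aval a * aval b
  | AScale c a => c *: aval a
  end.

(** Unfolds to nested pairs of equations in [Type], so that a tuple of equality proofs is itself a
    proof of validity. *)
Fixpoint rvalid (r : rtree (aexp F)) : Type :=
  match r with
  | RLeaf i j e => env`_i * env`_j = aval e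
  | RNode r1 r2 => (rvalid r1 * rvalid r2)%type
  end.

Fixpoint wval (w : seq nat) : A := if w is i :: w' then env`_i * wval w' else 1.
Fixpoint pval (p : ncpoly) : A :=
  if p is (c, w) :: p' then cval c *: wval w + pval p' else 0.

Let sound (f : nat -> seq nat -> ncpoly) :=
  forall i w, pval (f i w) = env`_i * wval w.

Lemma cmulE c d : cval (cmul c d) = cval c * cval d.
Proof. by case: c d => [a|] [b|] //=; rewrite ?mul1r ?mulr1. Qed.

Lemma word_eqP u v : word_eq u v -> u = v.
Proof.
elim: u v => [|i u IH] [|j v] //=; have [->|//] := @eqnP i j.
by move/IH ->.
Qed.

Lemma pval_insert c w p : pval (pinsert c w p) = cval c *: wval w + pval p.
Proof.
elim: p => //= -[d v] p IH; case: ifP => [/word_eqP ->|_] /=.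
  by rewrite scalerDl addrA.
by rewrite IH addrCA.
Qed.

Lemma pval_addscale c p q : pval (paddscale c p q) = cval c *: pval p + pval q.
Proof.
elim: p => [|[d w] p IH] /=; first by rewrite scaler0 add0r.
by rewrite pval_insert IH cmulE -scalerA scalerDr addrA.
Qed.

Lemma pval_bind p f a : (forall w, pval (f w) = a * wval w) ->
  pval (pbind p f) = a * pval p.
Proof.
move=> fa; elim: p => [|[c w] p IH] /=; first by rewrite mulr0.
by rewrite pval_addscale IH fa mulrDr scalerAr.
Qed.

Lemma pval_bindl p f b : (forall w, pval (f w) = wval w * b) ->
  pval (pbind p f) = pval p * b.
Proof.
move=> fa; elim: p => [|[c w] p IH] /=; first by rewrite mul0r.
by rewrite pval_addscale IH fa mulrDl scalerAl.
Qed.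

Lemma pval_pushw f u w : sound f -> pval (pushw f u w) = wval u * wval w.
Proof.
move=> sf; elim: u => [|i u IH] /=; first by rewrite addr0 scale1r mul1r.
by rewrite (pval_bind _ (sf i)) IH mulrA.
Qed.

Lemma pval_norm f e : sound f -> pval (anorm f e) = aval e.
Proof.
move=> sf; elim: e => [n|||a IHa b IHb|a IHa|a IHa b IHb|c a IHa] //=.
- by rewrite addr0 scale1r mulr1.
- by rewrite addr0 scale1r.
- by rewrite pval_addscale IHa IHb scale1r.
- by rewrite pval_addscale IHa addr0 scaleN1r.
- rewrite (@pval_bindl _ _ (aval b)) ?IHa // => u.
  by rewrite (@pval_bind _ _ (wval u)) ?IHb // => w; rewrite pval_pushw.
- by rewrite pval_addscale IHa addr0.
Qed.

Lemma push_trivial : sound (push None 0).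
Proof. by move=> i w /=; rewrite scale1r addr0. Qed.

Lemma rlookupP r i j p : rvalid r -> rlookup (rcompile r) i j = Some p ->
  env`_i * env`_j = pval p.
Proof.
elim: r => [i' j' e|r1 IH1 r2 IH2] /=.
  move=> v; have [->|//] := @eqnP i i'; have [->|//] := @eqnP j j'.
  by case=> <-; rewrite pval_norm //; exact: push_trivial.
move=> [v1 v2]; case E: rlookup => [p'|]; last exact: IH2.
by case=> pE; apply: IH1 => //; rewrite E pE.
Qed.

Lemma push_sound r k : rvalid r -> sound (push (Some (rcompile r)) k).
Proof.
move=> v; elim: k => [|k IH] i [|j w] /=; rewrite ?scale1r ?addr0 //.
case E: rlookup => [p|] /=; last by rewrite scale1r addr0.
rewrite (@pval_bindl _ _ (wval w)) => [|u]; last exact: pval_pushw.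
by rewrite -(rlookupP v E) mulrA.
Qed.

Lemma pvanishP p : pvanish p -> pval p = 0.
Proof. by elim: p => //= -[c w] p IH [-> /IH ->]; rewrite scale0r add0r. Qed.

(** Reflection: the reduced difference has the value [aval s - aval t] by soundness, and the value 0
    if all its coefficients vanish. *)
Lemma aval_eq r s t : rvalid r -> pvanish (reduced_diff r s t) ->
  aval s = aval t.
Proof.
move=> v /pvanishP; rewrite pval_norm; last exact: push_sound.
by move/eqP; rewrite subr_eq0 => /eqP.
Qed.

End Soundness.
End Normalization.

(** * Reification of equations in an algebra *)

Ltac atom_index x e :=
  match e with
  (* The inner match on [tt] runs [constr_eq] while a term is being built; its failure makes the
     outer match try the next branch. *)
  | ?y :: _ => let _ := match tt with _ => constr_eq x y end in constr:(O)
  | _ :: ?e' => let n := atom_index x e' in constr:(S n)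
  end.
Ltac alg_atoms e t :=
  lazymatch t with
  | (?a + ?b)%R => let e1 := alg_atoms e a in alg_atoms e1 b
  | (?a * ?b)%R => let e1 := alg_atoms e a in alg_atoms e1 b
  | (- ?a)%R => alg_atoms e a
  | (_ *: ?a)%R => alg_atoms e a
  | 0%R => e
  | 1%R => e
  | _ => match tt with
         | _ => let _ := atom_index t e in e
         | _ => constr:(t :: e)
         end
  end.
Ltac alg_reify F e t :=
  lazymatch t with
  | (?a + ?b)%R =>
      let a' := alg_reify F e a in let b' := alg_reify F e b in
      constr:(@AAdd F a' b')
  | (?a * ?b)%R =>
      let a' := alg_reify F e a in let b' := alg_reify F e b in
      constr:(@AMul F a' b')
  | (- ?a)%R => let a' := alg_reify F e a in constr:(@AOpp F a')
  | (?c *: ?a)%R => let a' := alg_reify F e a in constr:(@AScale F c a')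
  | 0%R => constr:(@AZero F)
  | 1%R => constr:(@AOne F)
  | _ => let n := atom_index t e in constr:(@AVar F n)
  end.
Ltac rule_atoms e T :=
  lazymatch T with
  | (?a * ?b)%type => let e1 := rule_atoms e a in rule_atoms e1 b
  | ?a = ?b => let e1 := alg_atoms e a in alg_atoms e1 b
  end.
Ltac rule_reify F e T :=
  lazymatch T with
  | (?a * ?b)%type =>
      let a' := rule_reify F e a in let b' := rule_reify F e b in
      constr:(@RNode (aexp F) a' b')
  | (?a * ?b)%R = ?c =>
      let i := atom_index a e in let j := atom_index b e in
      let c' := alg_reify F e c in constr:(@RLeaf (aexp F) i j c')
  end.
(* Reduces an equality in an algebra over [F] to the equality of the coefficients
   of the normal forms for the rules [r], a tuple of equations [x * y = ...]. *)
Ltac alg_coefs F r :=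
  let T := type of r in
  let T := eval cbv beta in T in
  lazymatch goal with |- @eq ?V ?s ?t =>
    let e := rule_atoms (@nil V) T in
    let e := alg_atoms e s in
    let e := alg_atoms e t in
    let r' := rule_reify F e T in
    let s' := alg_reify F e s in let t' := alg_reify F e t in
    refine (@aval_eq _ _ e r' s' t' r _);
    cbv [reduced_diff pvanish anorm rcompile push pushw rlookup pbind paddscale
         pinsert word_eq cmul cval eqn];
    repeat split
  end.

(** * Casimir operators in an abstract algebra *)

(** [K] and [K^-1] stand in for [A0], which enters the Casimir operator only through them. *)
Record gens (A : Type) := Gens {
  gAp : A; gAm : A; gK : A; gKi : A; gP : A }.

Section QuantumAlgebra.
Context (F : fieldType) (A : algType F) (h : F).
Implicit Types (x y z w : gens A) (a b c : A).

(** With [h = q^(1/2)] and [K = q^(A0/2)], the commutators of [A0] with [A+] and [A-] become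
    [h]-commutations with [K]. The relations are oriented as rewriting rules towards the order
    [A+ A- K P]. *)
Record osp_rel x : Prop := OspRel {
  osp_KKi : gK x * gKi x = 1;
  osp_KiK : gKi x * gK x = 1;
  osp_PP : gP x * gP x = 1;
  osp_PK : gP x * gK x = gK x * gP x;
  osp_PKi : gP x * gKi x = gKi x * gP x;
  osp_PAp : gP x * gAp x = - (gAp x * gP x);
  osp_PAm : gP x * gAm x = - (gAm x * gP x);
  osp_KAp : gK x * gAp x = h *: (gAp x * gK x);
  osp_KAm : gK x * gAm x = h^-1 *: (gAm x * gK x);
  osp_KiAp : gKi x * gAp x = h^-1 *: (gAp x * gKi x);
  osp_KiAm : gKi x * gAm x = h *: (gAm x * gKi x);
  osp_AmAp : gAm x * gAp x =
    (h - h^-1)^-1 *: (gK x * gK x - gKi x * gKi x) - gAp x * gAm x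
}.

Definition cas x : A :=
  (gAp x * gAm x - (h ^+ 2 - h ^- 2)^-1 *:
     (h^-1 *: (gK x * gK x) - h *: (gKi x * gKi x))) * gP x.

Definition coprod x y : gens A :=
  Gens (gAp x * (gK y * gP y) + gKi x * gAp y)
       (gAm x * (gK y * gP y) + gKi x * gAm y)
       (gK x * gK y) (gKi x * gKi y) (gP x * gP y).

Record commutes_gens a x : Prop := CommutesGens {
  comm_Ap : a * gAp x = gAp x * a;
  comm_Am : a * gAm x = gAm x * a;
  comm_K : a * gK x = gK x * a;
  comm_Ki : a * gKi x = gKi x * a;
  comm_P : a * gP x = gP x * a
}.

(** As rewriting rules, these move the generators of [y] to the right of those of [x]. *)
Record commuting x y : Prop := Commuting {
  Ap_comm : commutes_gens (gAp y) x;
  Am_comm : commutes_gens (gAm y) x;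
  K_comm : commutes_gens (gK y) x;
  Ki_comm : commutes_gens (gKi y) x;
  P_comm : commutes_gens (gP y) x
}.

(** The rule [osp_AmAp] is kept apart and added only where [A-] has to be moved past [A+]. *)
Definition osp_rules x (r : osp_rel x) :=
  (osp_KKi r, osp_KiK r,
   osp_PP r, osp_PK r,
   osp_PKi r, osp_PAp r,
   osp_PAm r, osp_KAp r,
   osp_KAm r, osp_KiAp r,
   osp_KiAm r).

Definition commutes_rules a x (r : commutes_gens a x) :=
  (comm_Ap r, comm_Am r,
   comm_K r, comm_Ki r,
   comm_P r).

Definition commuting_rules x y (r : commuting x y) :=
  (commutes_rules (Ap_comm r), commutes_rules (Am_comm r),
   commutes_rules (K_comm r), commutes_rules (Ki_comm r),
   commutes_rules (P_comm r)).

Hypotheses (h0 : h != 0) (h4 : h ^+ 4 != 1).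

(** This and the next facts clear the denominators [h - h^-1], [h + h^-1] and [h^2 - h^-2]. *)
Let h21 : h ^+ 2 - 1 != 0.
Proof.
by apply: contraNneq h4 => /eqP; rewrite subr_eq0 (exprM h 2 2) => /eqP ->;
  rewrite expr1n.
Qed.
Let h22 : h ^+ 2 + 1 != 0.
Proof.
apply: contraNneq h4 => /eqP; rewrite addr_eq0 (exprM h 2 2) => /eqP ->.
by rewrite sqrrN expr1n.
Qed.
Let h41 : h ^+ 4 - 1 != 0. Proof. by rewrite subr_eq0. Qed.

Let h41' : (h * h) ^+ 2 - 1 != 0. Proof. by rewrite -expr2 -exprM. Qed.

Ltac alg_close r := alg_coefs F r;
  (try by []); field; rewrite ?h0 ?h21 ?h22 ?h41 ?h41' //.

(** This is why the coproduct is an algebra homomorphism: each defining relation is checked in the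
    order where site [x] precedes site [y]. *)
Lemma osp_rel_coprod x y : osp_rel x -> osp_rel y -> commuting x y ->
  osp_rel (coprod x y).
Proof.
move=> rx ry cxy.
split; rewrite /=;
  alg_close (commuting_rules cxy, osp_rules rx, osp_rules ry, osp_AmAp rx,
             osp_AmAp ry).
Qed.

Lemma cas_central x : osp_rel x -> commutes_gens (cas x) x.
Proof.
by move=> rx; split; rewrite /cas; alg_close (osp_rules rx, osp_AmAp rx).
Qed.

(** * Expansions of the Casimir operator of a coproduct *)

Definition qc : F := h + h^-1.

Definition K2P x := gK x * gK x * gP x.
Definition Ki2P x := gKi x * gKi x * gP x.

Lemma cas_coprodl x y : osp_rel x -> osp_rel y -> commuting x y ->
  cas (coprod x y) = cas x * K2P y + Ki2P x * (cas y - qc^-1 *: K2P y)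
   + qc^-1 *: (gAm x * gKi x * gP x
                 * ((gAp y * K2P y - K2P y * gAp y) * (gKi y * gP y))
               - gAp x * gKi x * gP x
                 * ((gAm y * K2P y - K2P y * gAm y) * (gKi y * gP y))).
Proof.
move=> rx ry cxy; rewrite /cas /K2P /Ki2P /qc /=.
alg_close (commuting_rules cxy, osp_rules rx, osp_rules ry).
Qed.

(** Mirror image of [cas_coprodl], with coefficients on site [y] and [K^-2 P] of site [x] in place
    of [K^2 P]. *)
Lemma cas_coprodr x y : osp_rel x -> osp_rel y -> commuting x y ->
  cas (coprod x y) = Ki2P x * cas y + K2P y * (cas x - qc^-1 *: Ki2P x)
   + qc^-1 *: (gAp y * gK y * ((gAm x * Ki2P x - Ki2P x * gAm x) * gK x)
               - gAm y * gK y * ((gAp x * Ki2P x - Ki2P x * gAp x) * gK x)).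
Proof.
move=> rx ry cxy; rewrite /cas /K2P /Ki2P /qc /=.
alg_close (commuting_rules cxy, osp_rules rx, osp_rules ry).
Qed.

(** The off-diagonal parts [T+] and [T-] of the two-site Casimir operator: this one raises site [x]
    and lowers site [y], [ladder_dn] does the opposite. *)
Definition ladder_up x y := - (gAp x * gKi x * gP x * (gK y * gAm y)).
Definition ladder_dn x y := gKi x * gAm x * gP x * (gAp y * gK y).

Lemma cas_coprod_ladder x y s t : osp_rel x -> osp_rel y -> commuting x y ->
  cas x = s%:A -> cas y = t%:A ->
  cas (coprod x y) = s *: K2P y + t *: Ki2P x - qc^-1 *: (Ki2P x * K2P y)
    + ladder_up x y + ladder_dn x y.
Proof.
move=> rx ry cxy cx cy; rewrite cas_coprodl // cx cy /ladder_up /ladder_dn.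
rewrite /K2P /Ki2P /qc.
alg_close (commuting_rules cxy, osp_rules rx, osp_rules ry).
Qed.

(** * Cubic relations in abstract form *)

Lemma ApAm_cas x s : osp_rel x -> cas x = s%:A ->
  gAp x * gAm x = s *: gP x + (h ^+ 2 - h ^- 2)^-1 *:
     (h^-1 *: (gK x * gK x) - h *: (gKi x * gKi x)).
Proof.
move=> rx /(congr1 (fun a => a * gP x)); rewrite /cas -mulrA (osp_PP rx) mulr1.
by rewrite -scalerAl mul1r => <-; rewrite subrK.
Qed.

(** Up to the common factor [h^-2 K^-2 (x) K^2], the two products are [A-A+ (x) A+A-] and
    [A+A- (x) A-A+]. With scalar Casimir operators each factor is a polynomial in [K^2], [K^-2] and
    [P]; the weight [h^-4] makes the terms in [s t] cancel, because [A+A-] contains [s P] and [A-A+]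
    contains [- s P]. *)
Lemma ladder_comm x y s t : osp_rel x -> osp_rel y -> commuting x y ->
  cas x = s%:A -> cas y = t%:A ->
  (h ^+ 4 - 1) *: (ladder_dn x y * ladder_up x y
                   - h ^- 4 *: (ladder_up x y * ladder_dn x y)) =
  Ki2P x * Ki2P x * (K2P y * K2P y) - 1
  + qc *: (t *: K2P y + s *: Ki2P x - s *: (K2P y * K2P y * Ki2P x)
           - t *: (Ki2P x * Ki2P x * K2P y)).
Proof.
move=> rx ry cxy cx cy; rewrite /ladder_up /ladder_dn /K2P /Ki2P /qc.
alg_close (commuting_rules cxy, osp_rules rx, osp_rules ry, osp_AmAp rx,
  osp_AmAp ry, ApAm_cas rx cx, ApAm_cas ry cy).
Qed.

(** The coefficient [h^2 + h^-2] makes the terms [Tp Tp Y] and [Tm Tm Y] drop out, as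
    [1 + h^4 = (h^2 + h^-2) h^2]. The mixed terms add up to [-(h^4 - 1) (Tm Tp - h^-4 Tp Tm) Y],
    which the last hypothesis expresses in [Y], [Yi] and [Z]. *)
Lemma cubic_two_sites (Y Yi Z Tp Tm : A) (s t : F) :
  Y * Yi = 1 -> Yi * Y = 1 -> Z * Y = Y * Z -> Z * Yi = Yi * Z ->
  Y * Tp = - h ^+ 2 *: (Tp * Y) -> Yi * Tp = - h ^- 2 *: (Tp * Yi) ->
  Z * Tp = - h ^- 2 *: (Tp * Z) ->
  Y * Tm = - h ^- 2 *: (Tm * Y) -> Yi * Tm = - h ^+ 2 *: (Tm * Yi) ->
  Z * Tm = - h ^+ 2 *: (Tm * Z) ->
  (h ^+ 4 - 1) *: (Tm * Tp - h ^- 4 *: (Tp * Tm)) =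
    Yi * Yi * (Z * Z) - 1
    + qc *: (t *: Z + s *: Yi - s *: (Z * Z * Yi) - t *: (Yi * Yi * Z)) ->
  let O := s *: Z + t *: Yi - qc^-1 *: (Yi * Z) + Tp + Tm in
  O * (O * Y) + Y * (O * O) + (h ^+ 2 + h ^- 2) *: (O * (Y * O)) =
  Y - (qc * t) *: (Y * Z) - (qc * s)%:A
  + qc ^+ 2 *: (s *: (O * (Y * Z)) + t *: O).
Proof.
move=> r1 r2 r3 r4 r5 r6 r7 r8 r9 r10 r11.
(* Solved for [Tm * Tp], the hypothesis is a rule that moves [Tp] to the left of [Tm]. *)
have {}r11' : Tm * Tp = h ^- 4 *: (Tp * Tm) + (h ^+ 4 - 1)^-1 *:
    (Yi * Yi * (Z * Z) - 1
    + qc *: (t *: Z + s *: Yi - s *: (Z * Z * Yi) - t *: (Yi * Yi * Z))).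
  by rewrite -r11 scalerA mulVf // scale1r addrC subrK.
rewrite /qc /= in r11' *; alg_close (r1, r2, r3, r4, r5, r6, r7, r8, r9, r10, r11').
Qed.

(** The map [C(X) = O^2 X + X O^2 + (h^2 + h^-2) O X O] is linear and compatible with multiplication
    by anything commuting with [O]. Hence [C(1) = qc^2 O^2], and [C([E, Y] G) = [E, C(Y)] G], where
    the bracket kills the terms of [C(Y)] in 1 and [O]. Applying [C] to the three kinds of terms of
    [M] therefore turns [Y] into [N] in the way that builds [Q]. *)
Lemma cubic_extension (O Y N y u v E1 E2 G : A) (r s t : F) :
  O * (O * Y) + Y * (O * O) + (h ^+ 2 + h ^- 2) *: (O * (Y * O)) =
    Y - (qc * t) *: N - (qc * s)%:A + qc ^+ 2 *: (s *: (O * N) + t *: O) ->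
  N * O = O * N -> O * y = y * O -> O * u = u * O -> O * v = v * O ->
  O * E1 = E1 * O -> O * E2 = E2 * O -> G * O = O * G ->
  let M := r *: Y + y * (s%:A - qc^-1 *: Y) +
    qc^-1 *: (u * ((E1 * Y - Y * E1) * G) - v * ((E2 * Y - Y * E2) * G)) in
  let Q := r *: N + y * (O - qc^-1 *: N) +
    qc^-1 *: (u * ((E1 * N - N * E1) * G) - v * ((E2 * N - N * E2) * G)) in
  O * (O * M) + M * (O * O) + (h ^+ 2 + h ^- 2) *: (O * (M * O)) =
  M - (qc * t) *: Q - (qc * (r * s))%:A
  + qc ^+ 2 *: (s *: (O * Q) + (r * t) *: O).
Proof.
move=> r1 r2 r3 r4 r5 r6 r7 r8.
(* Naming [O * Y] turns the hypothesis on [Y] into a rule for a product of two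
   atoms. *)
pose W := O * Y; have rW : O * Y = W by [].
have {}r1 : O * W = Y - (qc * t) *: N - (qc * s)%:A
    + qc ^+ 2 *: (s *: (O * N) + t *: O)
    - (h ^+ 2 + h ^- 2) *: (O * (Y * O)) - Y * (O * O).
  by rewrite -r1 addrK addrK.
rewrite /qc /= in r1 *; alg_close (rW, r1, r2, r3, r4, r5, r6, r7, r8).
Qed.

(** Adds a known relation to the goal, so that a formal identity remains to be checked. *)
Lemma addr_eq_by a b c d : c = d -> a + c = b + d -> a = b.
Proof. by move=> ->; exact: addIr. Qed.

(** Once [I2] is substituted, the left-hand side of each conclusion contains the cubic expression of
    the matching hypothesis with coefficient -1; the rest agrees because [Q] commutes with [O] and
    [M]. *)
Lemma bannai_ito_relations (O M Q : A) (t1 t2 t3 : F) :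
  O * (O * M) + M * (O * O) + (h ^+ 2 + h ^- 2) *: (O * (M * O)) =
    M - (qc * t3) *: Q - (qc * (t1 * t2))%:A
    + qc ^+ 2 *: (t2 *: (O * Q) + (t1 * t3) *: O) ->
  M * (M * O) + O * (M * M) + (h ^+ 2 + h ^- 2) *: (M * (O * M)) =
    O - (qc * t1) *: Q - (qc * (t3 * t2))%:A
    + qc ^+ 2 *: (t2 *: (M * Q) + (t3 * t1) *: M) ->
  Q * O = O * Q -> Q * M = M * Q ->
  let I1 := - O in let I3 := - M in
  let I2 := h *: (I3 * I1) + h^-1 *: (I1 * I3)
    - qc *: (t3%:A * t1%:A + t2%:A * Q) in
  h *: (I1 * I2) + h^-1 *: (I2 * I1) = I3 + qc *: (t1%:A * t2%:A + t3%:A * Q)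
  /\ h *: (I2 * I3) + h^-1 *: (I3 * I2) = I1 + qc *: (t2%:A * t3%:A + t1%:A * Q).
Proof.
move=> r1 r2 r3 r4.
split; [apply: (addr_eq_by r1) | apply: (addr_eq_by r2)]; rewrite /qc.
  alg_close (r3, r4).
alg_close (r3, r4).
Qed.

(** * Commuting sites and their coproducts *)

Lemma commuting_sym x y : commuting x y -> commuting y x.
Proof. by case=> [[? ? ? ? ?] [? ? ? ? ?] [? ? ? ? ?] [? ? ? ? ?] [? ? ? ? ?]]. Qed.

Lemma commutes_coprod a x y :
  commutes_gens a x -> commutes_gens a y -> commutes_gens a (coprod x y).
Proof.
by move=> cx cy; split=> /=; alg_close (commutes_rules cx, commutes_rules cy).
Qed.

Lemma commutes_cas a x : commutes_gens a x -> a * cas x = cas x * a.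
Proof. by move=> cx; rewrite /cas; alg_close (commutes_rules cx). Qed.

Lemma commuting_coprodl x y z :
  commuting x z -> commuting y z -> commuting (coprod x y) z.
Proof. by case=> ? ? ? ? ? [? ? ? ? ?]; split; exact: commutes_coprod. Qed.

Lemma commuting_coprodr x y z :
  commuting x y -> commuting x z -> commuting x (coprod y z).
Proof.
move=> /commuting_sym cxy /commuting_sym cxz.
by apply/commuting_sym/commuting_coprodl.
Qed.

Lemma cas_commuting x y : commuting x y -> commutes_gens (cas y) x.
Proof.
by case/commuting_sym=> ? ? ? ? ?; split; apply/esym/commutes_cas.
Qed.

(** Coassociativity allows the total Casimir operator to be expanded from either end of the
    chain. *)
Lemma coprodA x y z : osp_rel y -> osp_rel z -> commuting y z ->
  coprod x (coprod y z) = coprod (coprod x y) z.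
Proof.
move=> ry rz cyz; rewrite /coprod /=; congr Gens;
  alg_close (commuting_rules cyz).
Qed.

Lemma K2P_coprod x y : commuting x y -> K2P (coprod x y) = K2P x * K2P y.
Proof. by move=> cxy; rewrite /K2P /=; alg_close (commuting_rules cxy). Qed.

Lemma Ki2P_coprod x y : commuting x y -> Ki2P (coprod x y) = Ki2P y * Ki2P x.
Proof. by move=> cxy; rewrite /Ki2P /=; alg_close (commuting_rules cxy). Qed.

(** * Cubic relations on two and three sites *)

Lemma cubic_K2P x y s t : osp_rel x -> osp_rel y -> commuting x y ->
  cas x = s%:A -> cas y = t%:A ->
  let O := cas (coprod x y) in let Y := K2P x in let Z := K2P y in
  O * (O * Y) + Y * (O * O) + (h ^+ 2 + h ^- 2) *: (O * (Y * O)) =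
  Y - (qc * t) *: (Y * Z) - (qc * s)%:A
  + qc ^+ 2 *: (s *: (O * (Y * Z)) + t *: O).
Proof.
move=> rx ry cxy cx cy; rewrite /= (cas_coprod_ladder rx ry cxy cx cy).
have lc := ladder_comm rx ry cxy cx cy.
apply: cubic_two_sites; last exact: lc.
all: rewrite /K2P /Ki2P /ladder_up /ladder_dn;
  alg_close (commuting_rules cxy, osp_rules rx, osp_rules ry).
Qed.

Lemma cubic_Ki2P x y s t : osp_rel x -> osp_rel y -> commuting x y ->
  cas x = s%:A -> cas y = t%:A ->
  let O := cas (coprod x y) in let Y := Ki2P y in let Z := Ki2P x in
  O * (O * Y) + Y * (O * O) + (h ^+ 2 + h ^- 2) *: (O * (Y * O)) =
  Y - (qc * s) *: (Y * Z) - (qc * t)%:A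
  + qc ^+ 2 *: (t *: (O * (Y * Z)) + s *: O).
Proof.
move=> rx ry cxy cx cy; rewrite /= (cas_coprod_ladder rx ry cxy cx cy).
have lc := ladder_comm rx ry cxy cx cy.
have c : K2P y * Ki2P x = Ki2P x * K2P y.
  by rewrite /K2P /Ki2P; alg_close (commuting_rules cxy).
(* Here [Y], [Yi] and [Z] are [Ki2P y], [K2P y] and [Ki2P x], and [s] and [t] are exchanged. The
   ladder operators keep their roles: [ladder_up] lowers site [y], so it has the same commutation
   factor with [K^-2 P] there as with [K^2 P] on site [x]. *)
rewrite -c (addrC (s *: _)); apply: cubic_two_sites; last first.
  by rewrite lc; alg_close c.
all: rewrite /K2P /Ki2P /ladder_up /ladder_dn;
  alg_close (commuting_rules cxy, osp_rules rx, osp_rules ry).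
Qed.

Lemma cubic_cas_left x y z r s t : osp_rel x -> osp_rel y -> osp_rel z ->
  commuting x y -> commuting x z -> commuting y z ->
  cas x = r%:A -> cas y = s%:A -> cas z = t%:A ->
  let O := cas (coprod y z) in let M := cas (coprod x y) in
  let Q := cas (coprod x (coprod y z)) in
  O * (O * M) + M * (O * O) + (h ^+ 2 + h ^- 2) *: (O * (M * O)) =
  M - (qc * t) *: Q - (qc * (r * s))%:A
  + qc ^+ 2 *: (s *: (O * Q) + (r * t) *: O).
Proof.
move=> rx ry rz cxy cxz cyz cx cy cz /=.
set w := coprod y z; set O := cas w.
have rw : osp_rel w by exact: osp_rel_coprod.
have cxw : commuting x w by exact: commuting_coprodr.
have cO : commutes_gens O w by exact: cas_central.
have cOx : commutes_gens O x by exact: cas_commuting.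
have := @cubic_extension O (K2P y) (K2P w) (Ki2P x) (gAm x * gKi x * gP x)
  (gAp x * gKi x * gP x) (gAp w) (gAm w) (gKi w * gP w) r s t.
(* In the coproduct of [A+] the summand [K^-1 (x) A+] commutes with [K2P y], and the factor [K P] on
   site [z] of the other one is cancelled by [K^-1 P]. *)
have -> : (gAp w * K2P y - K2P y * gAp w) * (gKi w * gP w) =
          (gAp y * K2P y - K2P y * gAp y) * (gKi y * gP y).
  rewrite /w /K2P /=.
  alg_close (commuting_rules cyz, osp_rules ry, osp_rules rz).
have -> : (gAm w * K2P y - K2P y * gAm w) * (gKi w * gP w) =
          (gAm y * K2P y - K2P y * gAm y) * (gKi y * gP y).
  rewrite /w /K2P /=.
  alg_close (commuting_rules cyz, osp_rules ry, osp_rules rz).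
cbv zeta; rewrite (cas_coprodl rx ry cxy) (cas_coprodl rx rw cxw) cx cy.
rewrite -!scalerAl !mul1r; apply.
- by rewrite K2P_coprod //; exact: cubic_K2P.
- rewrite -/O /K2P; alg_close (commutes_rules cO).
all: rewrite /Ki2P; alg_close (commutes_rules cO, commutes_rules cOx).
Qed.

(** Mirror image of [cubic_cas_left]: coefficients now lie on site [z], and coassociativity presents
    [Q] as a coproduct of the first two sites with the third. *)
Lemma cubic_cas_right x y z r s t : osp_rel x -> osp_rel y -> osp_rel z ->
  commuting x y -> commuting x z -> commuting y z ->
  cas x = r%:A -> cas y = s%:A -> cas z = t%:A ->
  let O := cas (coprod x y) in let M := cas (coprod y z) in
  let Q := cas (coprod x (coprod y z)) in
  O * (O * M) + M * (O * O) + (h ^+ 2 + h ^- 2) *: (O * (M * O)) =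
  M - (qc * r) *: Q - (qc * (t * s))%:A
  + qc ^+ 2 *: (s *: (O * Q) + (t * r) *: O).
Proof.
move=> rx ry rz cxy cxz cyz cx cy cz /=.
rewrite (coprodA _ ry rz cyz); set w := coprod x y; set O := cas w.
have rw : osp_rel w by exact: osp_rel_coprod.
have cwz : commuting w z by exact: commuting_coprodl.
have cO : commutes_gens O w by exact: cas_central.
have cOz : commutes_gens O z by exact/cas_commuting/commuting_sym.
have := @cubic_extension O (Ki2P y) (Ki2P w) (K2P z) (gAp z * gK z)
  (gAm z * gK z) (gAm w) (gAp w) (gK w) t s r.
(* This time the summand [A- (x) K P] commutes with [Ki2P y], and the factor [K^-1] on site [x] of
   the other one is cancelled by [K]. *)
have -> : (gAm w * Ki2P y - Ki2P y * gAm w) * gK w =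
          (gAm y * Ki2P y - Ki2P y * gAm y) * gK y.
  rewrite /w /Ki2P /=.
  alg_close (commuting_rules cxy, osp_rules rx, osp_rules ry).
have -> : (gAp w * Ki2P y - Ki2P y * gAp w) * gK w =
          (gAp y * Ki2P y - Ki2P y * gAp y) * gK y.
  rewrite /w /Ki2P /=.
  alg_close (commuting_rules cxy, osp_rules rx, osp_rules ry).
cbv zeta; rewrite (cas_coprodr ry rz cyz) (cas_coprodr rw rz cwz) cy cz.
rewrite -!scalerAr !mulr1; apply.
- by rewrite Ki2P_coprod //; exact: cubic_Ki2P.
- rewrite -/O /Ki2P; alg_close (commutes_rules cO).
all: rewrite /K2P; alg_close (commutes_rules cO, commutes_rules cOz).
Qed.

Lemma bannai_ito_three_sites x y z r s t :
  osp_rel x -> osp_rel y -> osp_rel z ->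
  commuting x y -> commuting x z -> commuting y z ->
  cas x = r%:A -> cas y = s%:A -> cas z = t%:A ->
  let Q := cas (coprod x (coprod y z)) in
  let I1 := - cas (coprod y z) in let I3 := - cas (coprod x y) in
  let I2 := h *: (I3 * I1) + h^-1 *: (I1 * I3)
    - qc *: (cas z * cas x + cas y * Q) in
  h *: (I1 * I2) + h^-1 *: (I2 * I1) = I3 + qc *: (cas x * cas y + cas z * Q)
  /\ h *: (I2 * I3) + h^-1 *: (I3 * I2) = I1 + qc *: (cas y * cas z + cas x * Q).
Proof.
move=> rx ry rz cxy cxz cyz cx cy cz; rewrite /= cx cy cz.
have rxy := osp_rel_coprod rx ry cxy; have ryz := osp_rel_coprod ry rz cyz.
apply: bannai_ito_relations.
- exact: (cubic_cas_left rx ry rz cxy cxz cyz cx cy cz).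
- exact: (cubic_cas_right rx ry rz cxy cxz cyz cx cy cz).
- apply/esym/commutes_cas/commutes_coprod; last exact: cas_central.
  exact/cas_commuting/commuting_coprodr.
- rewrite (coprodA _ ry rz cyz).
  apply/esym/commutes_cas/commutes_coprod; first exact: cas_central.
  exact/cas_commuting/commuting_sym/commuting_coprodl.
Qed.
End QuantumAlgebra.

Definition gens_map (A A' : Type) (f : A -> A') (x : gens A) : gens A' :=
  Gens (f (gAp x)) (f (gAm x)) (f (gK x)) (f (gKi x)) (f (gP x)).

(** * Transport along algebra morphisms *)

Section Morphisms.
Context (F : fieldType) (A A' : algType F) (h : F) (f : {lrmorphism A -> A'}).

Lemma osp_rel_map x : osp_rel h x -> osp_rel h (gens_map f x).
Proof.
case=> e1 e2 e3 e4 e5 e6 e7 e8 e9 e10 e11 e12; split=> /=.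
1-3: by rewrite -rmorphM ?e1 ?e2 ?e3 rmorph1.
1-2: by rewrite -!rmorphM ?e4 ?e5.
1-2: by rewrite -!rmorphM ?e6 ?e7 rmorphN.
all: cycle 4.
by rewrite -!rmorphM e12 rmorphB /= linearZ /= rmorphB !rmorphM.
all: by rewrite -!rmorphM ?e8 ?e9 ?e10 ?e11 /= linearZ.
Qed.

Lemma cas_map x : cas h (gens_map f x) = f (cas h x).
Proof.
have fZ a u : f (a *: u) = a *: f u by exact: linearZ.
by rewrite /cas /= rmorphM /= rmorphB /= fZ rmorphB /= !fZ !rmorphM.
Qed.
End Morphisms.

(** * Linear maps and tensor products *)

Section LinearMaps.
Context (K : nzRingType) (mulKC : commutative (@GRing.mul K)) (V : lmodType K).

Lemma linear_lincomb (a : K) (f g : V -> V) :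
  linear f -> linear g -> linear (a *: f + g).
Proof.
move=> lf lg c u v.
rewrite -![(a *: f + g) _]/(a *: f _ + g _) lf lg !scalerDr !scalerA.
by rewrite (mulKC a) addrACA.
Qed.

Lemma linear_scalef (a : K) (f : V -> V) : linear f -> linear (a *: f).
Proof.
move=> lf c u v; rewrite -![(a *: f) _]/(a *: f _) lf scalerDr !scalerA.
by rewrite (mulKC a).
Qed.

Lemma linear_subf (f g : V -> V) : linear f -> linear g -> linear (f - g).
Proof.
move=> lf lg c u v; rewrite -![(f - g) _]/(f _ - g _) lf lg opprD addrACA.
by rewrite scalerBr.
Qed.

Lemma id_linear : linear (id : V -> V). Proof. by []. Qed.

Lemma comp_linear (f g : V -> V) : linear f -> linear g -> linear (f \o g).
Proof. by move=> lf lg a u v /=; rewrite lg lf. Qed.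

Lemma linear_funD (f : V -> V) u v : linear f -> f (u + v) = f u + f v.
Proof. by move=> lf; have := lf 1 u v; rewrite !scale1r. Qed.

Lemma linear_fun0 (f : V -> V) : linear f -> f 0 = 0.
Proof. by move=> lf; have := lf (-1) 0 0; rewrite !scaleN1r !addNr. Qed.

Lemma linear_funZ (f : V -> V) a v : linear f -> f (a *: v) = a *: f v.
Proof. by move=> lf; have := lf a v 0; rewrite (linear_fun0 lf) !addr0. Qed.
End LinearMaps.

(** * The algebra of linear endomorphisms *)

Section EndomorphismAlgebra.
Context (R : realType) (B : choiceType).
Local Notation K := R[i].
Local Notation V := {malg K[B]}.

(** Composition distributes over sums on both sides for linear maps, not for all functions; the
    abstract algebra results are applied to this subspace of [V -> V]. *)
Definition endo_pred : {pred V -> V} := [pred f | `[< linear f >]].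

Lemma endo_submod : submod_closed endo_pred.
Proof.
split=> [|a f g /asboolP lf /asboolP lg]; apply/asboolP.
  by move=> c u v; rewrite -![(0 : V -> V) _]/(0 : V) scaler0 addr0.
exact: (linear_lincomb (@mulrC R[i])).
Qed.
HB.instance Definition _ :=
  GRing.isSubmodClosed.Build K (V -> V) endo_pred endo_submod.

(* The index [b] makes the algebra nontrivial. *)
Record endo (b : B) := Endo {
  endo_val :> V -> V;
  _ : endo_val \in endo_pred }.

Context (b : B).
HB.instance Definition _ := [isSub for @endo_val b].
HB.instance Definition _ := [Choice of endo b by <:].
HB.instance Definition _ := [SubChoice_isSubLmodule of endo b by <:].

Lemma endo_linear (f : endo b) : linear f.
Proof. by case: f => f lf; apply/asboolP. Qed.

Lemma endo_eq (f g : endo b) : (f : V -> V) = g -> f = g.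
Proof. exact: val_inj. Qed.

Definition mkendo (f : V -> V) (lf : linear f) : endo b :=
  Endo b (introT (asboolP (linear f)) lf : f \in endo_pred).

Definition endo1 : endo b := mkendo (@id_linear _ _).
Definition endo_mul (f g : endo b) : endo b :=
  mkendo (comp_linear (endo_linear f) (endo_linear g)).

Fact endo_mulA : associative endo_mul. Proof. by move=> f g k; apply: endo_eq. Qed.
Fact endo_mul1r : left_id endo1 endo_mul. Proof. by move=> f; apply: endo_eq. Qed.
Fact endo_mulr1 : right_id endo1 endo_mul. Proof. by move=> f; apply: endo_eq. Qed.
Fact endo_mulDl : left_distributive endo_mul +%R.
Proof. by move=> f g k; apply: endo_eq. Qed.
Fact endo_mulDr : right_distributive endo_mul +%R.
Proof.
move=> f g k; apply: endo_eq; apply: funext => v.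
exact: linear_funD (endo_linear f).
Qed.
Fact endo1_neq0 : endo1 != 0.
Proof.
apply/eqP => /(congr1 (fun f : endo b => f << b >>)).
rewrite -[LHS]/(<< b >> : V) -[RHS]/(0 : V) => /(congr1 (mcoeff b)) /eqP.
by rewrite mcoeffUU mcoeff0 oner_eq0.
Qed.
HB.instance Definition _ := GRing.Zmodule_isNzRing.Build (endo b)
  endo_mulA endo_mul1r endo_mulr1 endo_mulDl endo_mulDr endo1_neq0.
Fact endo_scaleAl (a : K) (f g : endo b) : a *: (f * g) = (a *: f) * g.
Proof. by apply: endo_eq. Qed.
HB.instance Definition _ := GRing.Lmodule_isLalgebra.Build K (endo b) endo_scaleAl.
Fact endo_scaleAr (a : K) (f g : endo b) : a *: (f * g) = f * (a *: g).
Proof.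
apply: endo_eq; apply: funext => v.
exact: esym (linear_funZ a (g v) (endo_linear f)).
Qed.
HB.instance Definition _ := GRing.Lalgebra_isAlgebra.Build K (endo b) endo_scaleAr.

Lemma endo_valD (f g : endo b) : endo_val (f + g) = endo_val f + endo_val g.
Proof. by []. Qed.
Lemma endo_valN (f : endo b) : endo_val (- f) = - endo_val f.
Proof. by []. Qed.
Lemma endo_valZ a (f : endo b) : endo_val (a *: f) = a *: endo_val f.
Proof. by []. Qed.
Lemma endo_val0 : endo_val (0 : endo b) = 0.
Proof. by []. Qed.
End EndomorphismAlgebra.

(** * Weighted shifts and tensor products of linear maps *)

Section TensorMaps.
Context (K : nzRingType) (mulKC : commutative (@GRing.mul K)).

Lemma linear_linext (B : choiceType) (V : lmodType K) (f : {malg K[B]} -> V) :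
  linear f -> f = linext (fun b => f << b >>).
Proof.
move=> lf; have f0 : f 0 = 0.
  by have := lf (-1) 0 0; rewrite !scaleN1r !addNr.
apply: funext => v; rewrite {1}(monalgE v) /linext.
elim/big_rec2: _ => [|b x y _ <-] //; rewrite -lf; congr (f (_ + _)).
by apply/malgP => k; rewrite mcoeffZ !mcoeffU mulrnAr mulr1.
Qed.

Lemma linear_ext (B : choiceType) (V : lmodType K) (f g : {malg K[B]} -> V) :
  linear f -> linear g -> (forall b, f << b >> = g << b >>) -> f = g.
Proof.
move=> lf lg fg; rewrite (linear_linext lf) (linear_linext lg).
by apply: funext => v; apply: eq_bigr => b _; rewrite fg.
Qed.

Section Shifts.
Context (B : choiceType).
Local Notation V := {malg K[B]}.
Local Notation shift c h := (linext (fun b : B => (c b : K) *: (<< h b : B >> : V))).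

Lemma shift_rel (a : K) (c d c' d' : B -> K) (h k h' k' : B -> B) :
  (forall b, h (k b) = h' (k' b)) ->
  (forall b, d b * c (k b) = a * (d' b * c' (k' b))) ->
  shift c h \o shift d k = a *: (shift c' h' \o shift d' k').
Proof.
move=> eh ec; have ls c1 h1 : linear (shift c1 h1) by exact: linext_linear.
have -> : a *: (shift c' h' \o shift d' k') =
    a *: (shift c' h' \o shift d' k') + (0 : V -> V) by rewrite addr0.
apply: linear_ext => [||b].
- exact: comp_linear.
- apply: (linear_lincomb mulKC); first exact: comp_linear.
  by move=> ? ? ?; rewrite -![(0 : V -> V) _]/(0 : V) scaler0 addr0.
- rewrite addr0 -[RHS]/(a *: shift c' h' (shift d' k' << b >>)) /=.
  by rewrite !linextU !linextZ !linextU !scalerA eh ec mulrA.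
Qed.

Lemma shift_rel_id (c d : B -> K) :
  (forall b, d b * c b = 1) -> shift c id \o shift d id = id.
Proof.
move=> cd; have ls c1 h1 : linear (shift c1 h1) by exact: linext_linear.
apply: linear_ext => [||b]; [exact: comp_linear|by []|].
by rewrite /= !linextU !linextZ !linextU scalerA cd scale1r.
Qed.

Lemma shift_scalar (a : K) (f : V -> V) : linear f ->
  (forall b, f << b >> = a *: << b >>) -> f = a *: id.
Proof.
move=> lf fE; have la := linear_scalef mulKC a (@id_linear K V).
by apply: (linear_ext lf la) => b; rewrite fE.
Qed.

(** Every summand is diagonal in the basis, so one eigenvalue per basis vector has to be compared
    with [t]. *)
Lemma casimir_shift (d a a' t : K) (cp cm ck ci e s : B -> K) (hp hm : B -> B) :
  (forall b, (cm b * cp (hm b)) *: << hp (hm b) >> = s b *: << b >> :> V) ->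
  (forall b, e b * (s b - d * (a * (ck b * ck b) - a' * (ci b * ci b))) = t) ->
  ((shift cp hp \o shift cm hm)
     - d *: (a *: (shift ck id \o shift ck id)
             - a' *: (shift ci id \o shift ci id))) \o shift e id = t *: id.
Proof.
move=> es et; have ls c1 h1 : linear (shift c1 h1) by exact: linext_linear.
have lf : linear ((shift cp hp \o shift cm hm)
     - d *: (a *: (shift ck id \o shift ck id)
             - a' *: (shift ci id \o shift ci id))).
  apply: linear_subf; first exact: comp_linear.
  apply: (linear_scalef mulKC); apply: linear_subf;
    by apply: (linear_scalef mulKC); exact: comp_linear.
have lc := comp_linear lf (ls e id).
apply: shift_scalar lc _ => b.
rewrite /= linextU (linear_funZ _ _ lf) -(et b) -scalerA; congr (_ *: _).
rewrite -[LHS]/(shift cp hp (shift cm hm << b >>)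
  - d *: (a *: (shift ck id (shift ck id << b >>))
          - a' *: (shift ci id (shift ci id << b >>)))).
rewrite !linextU !linextZ !linextU.
rewrite !(scalerA (cm b)) !(scalerA (ck b)) !(scalerA (ci b)) es.
by rewrite !scalerBl -!scalerA !scalerBl -!scalerA.
Qed.
End Shifts.

Context (A B : choiceType).
Implicit Types (f : {malg K[A]} -> {malg K[A]}) (g : {malg K[B]} -> {malg K[B]}).

Lemma tens_linearl (v : {malg K[B]}) : linear (fun u : {malg K[A]} => tens u v).
Proof. exact: linext_linear. Qed.

Lemma tens_linearr (u : {malg K[A]}) : linear (tens u : {malg K[B]} -> _).
Proof.
have E v : tens u v =
  \sum_(a <- msupp u) u@_a *: linext (fun b : B => << (a, b) >>) v by [].
move=> c v w; rewrite !E scaler_sumr -big_split /=; apply: eq_bigr => a _.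
by rewrite linext_linear scalerDr !scalerA (mulKC c).
Qed.

Lemma tensUU (a : A) (b : B) : tens << a >> << b >> = << (a, b) >> :> {malg K[_]}.
Proof. by rewrite /tens !linextU. Qed.

Lemma tmap_linear f g : linear (tmap f g).
Proof. exact: linext_linear. Qed.

Lemma tmapU f g (a : A) (b : B) : tmap f g << (a, b) >> = tens (f << a >>) (g << b >>).
Proof. by rewrite /tmap linextU. Qed.

Lemma linear_comp (U V W : lmodType K) (f : V -> W) (g : U -> V) :
  linear f -> linear g -> linear (fun u => f (g u)).
Proof. by move=> lf lg a u v; rewrite lg lf. Qed.

(** Extension by linearity twice: in the second argument with a basis vector in the first, then in
    the first. *)
Lemma tmap_tens f g u v : linear f -> linear g ->
  tmap f g (tens u v) = tens (f u) (g v).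
Proof.
move=> lf lg; have lT := tmap_linear f g.
suff E a : (fun w => tmap f g (tens << a >> w)) = fun w => tens (f << a >>) (g w).
  apply: (congr1 (fun k : {malg K[A]} -> _ => k u)
    (_ : (fun w => tmap f g (tens w v)) = fun w => tens (f w) (g v))).
  apply: linear_ext => [||a].
  - exact: (linear_comp lT (tens_linearl v)).
  - exact: (linear_comp (tens_linearl (g v)) lf).
  - exact: (congr1 (fun k : {malg K[B]} -> _ => k v) (E a)).
apply: linear_ext => [||b].
- exact: (linear_comp lT (tens_linearr _)).
- exact: (linear_comp (tens_linearr _) lg).
- by rewrite tensUU tmapU.
Qed.

Lemma tmap_comp f f' g g' : linear f -> linear g ->
  tmap (f \o f') (g \o g') = tmap f g \o tmap f' g'.
Proof.
move=> lf lg; apply: linear_ext => [||[a b]].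
- exact: tmap_linear.
- exact: (linear_comp (tmap_linear f g) (tmap_linear f' g')).
- by rewrite /= !tmapU tmap_tens.
Qed.

Lemma tmap_id : tmap id id = id :> ({malg K[(A * B)%type]} -> _).
Proof.
apply: linear_ext => [||[a b]]; [exact: tmap_linear|by []|].
by rewrite tmapU tensUU.
Qed.

Lemma tmap_linearl g : linear (fun f => tmap f g).
Proof.
move=> c f f'; apply: linear_ext => [||[a b]]; first exact: tmap_linear.
  by apply: (linear_lincomb mulKC); exact: tmap_linear.
rewrite -[RHS]/(c *: tmap f g << (a, b) >> + tmap f' g << (a, b) >>) !tmapU.
exact: tens_linearl.
Qed.

Lemma tmap_linearr f : linear (fun g => tmap f g).
Proof.
move=> c g g'; apply: linear_ext => [||[a b]]; first exact: tmap_linear.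
  by apply: (linear_lincomb mulKC); exact: tmap_linear.
rewrite -[RHS]/(c *: tmap f g << (a, b) >> + tmap f g' << (a, b) >>) !tmapU.
exact: tens_linearr.
Qed.

Lemma tmap_compl f f' : linear f ->
  tmap (f \o f') id = tmap f id \o tmap f' id :> ({malg K[(A * B)%type]} -> _).
Proof. by move=> lf; exact: (@tmap_comp f f' id id lf (@id_linear K {malg K[B]})). Qed.

Lemma tmap_compr g g' : linear g ->
  tmap id (g \o g') = tmap id g \o tmap id g' :> ({malg K[(A * B)%type]} -> _).
Proof. by move=> lg; exact: (@tmap_comp id id g g' (@id_linear K {malg K[A]}) lg). Qed.

Lemma tmap_swap f g : linear f -> linear g ->
  tmap id g \o tmap f id = tmap f id \o tmap id g.
Proof.
move=> lf lg; transitivity (tmap f g).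
  exact: esym (@tmap_comp id f g id (@id_linear K {malg K[A]}) lg).
exact: (@tmap_comp f id id g lf (@id_linear K {malg K[B]})).
Qed.
End TensorMaps.

(** * The three embeddings of operators into the triple tensor product *)

Section Slots.
Context (R : realType).
Local Notation V := {malg R[i][nat]}.
Implicit Types (f g : V -> V) (i j : 'I_3).

Lemma slot_linear i f : linear (slot i f).
Proof. by case: i => -[|[|n]] lt; exact: tmap_linear. Qed.

Lemma slot_id i : slot i id = id :> (W3 R -> W3 R).
Proof. by case: i => -[|[|n]] lt; rewrite /slot /= ?tmap_id. Qed.

Local Notation V2 := {malg R[i][(nat * nat)%type]}.
Let lift (f : V2 -> V2) : W3 R -> W3 R := tmap f (id : V -> V).
Local Notation tli := (@tmap_linear R[i]).
Let RiC : commutative (@GRing.mul R[i]) := @mulrC R[i].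

(** The triple product is nested to the left, so the first two slots use multiplicativity of [tmap]
    at both levels. *)
Lemma slot_comp i f g : linear f -> linear g ->
  slot i (f \o g) = slot i f \o slot i g.
Proof.
move=> lf lg; case: i => -[|[|n]] lt.
- by have e := etrans (congr1 lift (@tmap_compl R[i] RiC nat nat f g lf))
    (@tmap_compl R[i] RiC (nat * nat)%type nat (tmap f id) (tmap g id)
       (tli f id)); exact e.
- by have e := etrans (congr1 lift (@tmap_compr R[i] RiC nat nat f g lf))
    (@tmap_compl R[i] RiC (nat * nat)%type nat (tmap id f) (tmap id g)
       (tli id f)); exact e.
- exact: (@tmap_compr R[i] RiC (nat * nat)%type nat f g lf).
Qed.

Lemma slot_lincomb i c f g : slot i (c *: f + g) = c *: slot i f + slot i g.
Proof.
have h (k l : V2 -> V2) : lift (c *: k + l) = c *: lift k + lift l.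
  pose a := @tmap_linearl R[i] RiC (nat * nat)%type nat id; exact (a c k l).
case: i => -[|[|n]] lt.
- pose a := @tmap_linearl R[i] RiC nat nat id.
  have e := etrans (congr1 lift (a c f g)) (h _ _); exact e.
- pose a := @tmap_linearr R[i] RiC nat nat id.
  have e := etrans (congr1 lift (a c f g)) (h _ _); exact e.
- pose a := @tmap_linearr R[i] RiC (nat * nat)%type nat id; exact (a c f g).
Qed.

Lemma slot_commute i j f g : (i < j)%N -> linear f -> linear g ->
  slot j g \o slot i f = slot i f \o slot j g.
Proof.
move=> lt_ij lf lg; case: i j lt_ij => -[|[|n]] lti [[|[|m]] ltj] lt_ij.
all: try by exfalso; move: lt_ij; clear; (discriminate || case: n).
all: try by exfalso; case: m ltj lt_ij.
- by have e := etrans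
      (esym (@tmap_compl R[i] RiC (nat * nat)%type nat (tmap id g) (tmap f id)
               (tli id g)))
    (etrans (congr1 lift (@tmap_swap R[i] RiC nat nat f g lf lg))
            (@tmap_compl R[i] RiC (nat * nat)%type nat (tmap f id) (tmap id g)
               (tli f id))); exact e.
- exact: (@tmap_swap R[i] RiC (nat * nat)%type nat (tmap f id) g (tli f id) lg).
- exact: (@tmap_swap R[i] RiC (nat * nat)%type nat (tmap id f) g (tli id f) lg).
Qed.

Local Notation E1 := (endo R 0%N).
Local Notation E3 := (endo R (0%N, 0%N, 0%N)).

Definition slot_endo i (f : E1) : E3 := mkendo _ (slot_linear i f).

Lemma slot_endo_linear i : linear (slot_endo i).
Proof. by move=> c f g; apply: endo_eq; exact: slot_lincomb. Qed.

Lemma slot_endo_monoid i : monoid_morphism (slot_endo i).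
Proof.
split=> [|f g]; apply: endo_eq; first exact: slot_id.
by apply: slot_comp; exact: endo_linear.
Qed.

HB.instance Definition _ i :=
  GRing.isLinear.Build R[i] E1 E3 _ (slot_endo i) (slot_endo_linear i).
HB.instance Definition _ i :=
  GRing.isMonoidMorphism.Build E1 E3 (slot_endo i) (slot_endo_monoid i).

Lemma slot_endo_commute i j (f g : E1) : (i < j)%N ->
  slot_endo j g * slot_endo i f = slot_endo i f * slot_endo j g.
Proof.
by move=> ij; apply: endo_eq; apply: slot_commute => //; exact: endo_linear.
Qed.

Lemma slot_commuting i j x y : (i < j)%N ->
  commuting (gens_map (slot_endo i) x) (gens_map (slot_endo j) y).
Proof. by move=> ij; do 2!split=> /=; exact: slot_endo_commute. Qed.
End Slots.

(** * The representations *)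

Section Scalars.
Context (R : realType) (q : R) (q0 : 0 < q) (q1 : q < 1).
Local Notation h := (qpow q 2^-1).

Lemma qpowD a b : qpow q (a + b) = qpow q a * qpow q b.
Proof. by rewrite /qpow powRD ?(gt_eqF q0) ?implybT // rmorphM. Qed.

Lemma qpow0 : qpow q 0 = 1. Proof. by rewrite /qpow powRr0. Qed.

Lemma qpow1 : qpow q 1 = q%:C. Proof. by rewrite /qpow powRr1 // ltW. Qed.

Lemma qpow_neq0 a : qpow q a != 0.
Proof. by rewrite /qpow fmorph_eq0 gt_eqF // powR_gt0. Qed.

Lemma qpowN a : qpow q (- a) = (qpow q a)^-1.
Proof.
apply: (mulfI (qpow_neq0 a)).
by rewrite -qpowD subrr qpow0 mulfV // qpow_neq0.
Qed.

Lemma qpow_half_sqr : h ^+ 2 = q%:C.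
Proof.
have e : 1 = 2^-1 + 2^-1 :> R by rewrite [LHS]splitr mul1r.
by rewrite expr2 -qpowD -e qpow1.
Qed.

(** The fourth power of [h] is [q^2], which is less than 1. *)
Lemma qpow_half_neq1 : h ^+ 4 != 1.
Proof.
rewrite (exprM h 2 2) qpow_half_sqr -rmorphXn -(rmorph1 (real_complex R)).
by rewrite fmorph_eq expr2 lt_eqF // mulr_ilt1 // ltW.
Qed.

Lemma qdiffE : ((q - q^-1)^-1)%:C = (h ^+ 2 - h ^- 2)^-1 :> R[i].
Proof. by rewrite fmorphV rmorphB fmorphV qpow_half_sqr. Qed.

Lemma qhalfE : ((q `^ 2^-1 - q `^ (- 2^-1))^-1)%:C = (h - h^-1)^-1 :> R[i].
Proof. by rewrite fmorphV rmorphB -qpowN. Qed.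
End Scalars.

Section Casimir.
Context (R : realType) (q : R) (q0 : 0 < q) (B : choiceType) (b : B).
Local Notation V := {malg R[i][B]}.

Record represents (X : osp_ops V) (x : gens (endo R b)) : Prop := Represents {
  repr_Ap : opAp X = gAp x;
  repr_Am : opAm X = gAm x;
  repr_K : opK X = gK x;
  repr_Ki : opKi X = gKi x;
  repr_P : opP X = gP x
}.

Lemma casimirE X x : represents X x -> casimir q X = cas (qpow q 2^-1) x.
Proof.
case=> eAp eAm eK eKi eP.
by rewrite /casimir eAp eAm eK eKi eP (qdiffE q0) (qpowN q0).
Qed.

Lemma comul_represents X Y x y : represents X x -> represents Y y ->
  represents (comul X Y) (coprod x y).
Proof.
by case=> eAp eAm eK eKi eP [fAp fAm fK fKi fP]; split;
  rewrite /= ?eAp ?eAm ?eK ?eKi ?eP ?fAp ?fAm ?fK ?fKi ?fP.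
Qed.
End Casimir.

(** * The modules [W^(eps, mu)] in the abstract setting *)

Section Irreps.
Context (R : realType) (q eps mu : R) (q0 : 0 < q) (q1 : q < 1).
Context (he : eps = 1 \/ eps = -1) (mu0 : 0 < mu).
Local Notation h := (qpow q 2^-1).
Local Notation X := (irrep q eps mu).
Local Notation V := {malg R[i][nat]}.
Let weight n : R := n%:R + mu + 2^-1.

Definition irrep_gens : gens (endo R 0%N) :=
  Gens (mkendo 0%N (linext_linear _ : linear (opAp X)))
       (mkendo 0%N (linext_linear _ : linear (opAm X)))
       (mkendo 0%N (linext_linear _ : linear (opK X)))
       (mkendo 0%N (linext_linear _ : linear (opKi X)))
       (mkendo 0%N (linext_linear _ : linear (opP X))).

Local Notation x := irrep_gens.

Let kc n : R[i] := qpow q (weight n / 2).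
Let kic n : R[i] := qpow q (- weight n / 2).
Let apc n : R[i] := (Num.sqrt (sigma q mu n.+1))%:C.
Let amc n : R[i] := (Num.sqrt (sigma q mu n))%:C.
Let pc n : R[i] := (eps * (-1) ^+ n)%:C.
Let RiC : commutative (@GRing.mul R[i]) := @mulrC R[i].

Let weightS n : weight n.+1 = weight n + 1.
Proof. by rewrite /weight -natr1; ring. Qed.
Let kcS n : kc n.+1 = h * kc n.
Proof. by rewrite /kc weightS mulrDl mul1r addrC qpowD. Qed.
Let kicS n : kic n.+1 = h^-1 * kic n.
Proof. by rewrite /kic weightS opprD mulrDl mulN1r addrC qpowD // (qpowN q0). Qed.
Let h0 : h != 0. Proof. exact: qpow_neq0. Qed.
Let kcV n : kc n = h^-1 * kc n.+1.
Proof. by rewrite kcS mulKf. Qed.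
Let kicV n : kic n = h * kic n.+1.
Proof. by rewrite kicS mulVKf. Qed.
Let kcK n : kic n * kc n = 1.
Proof. by rewrite /kc /kic mulNr -qpowD // addNr qpow0. Qed.
Let amc0 : amc 0 = 0. Proof. by rewrite /amc sigma0 sqrtr0. Qed.

(** Relations with [K] are comparisons of weights of shifts, based on [kcS] and [kicS]; the others
    come from [irrep_osp]. *)
Lemma irrep_gens_osp : osp_rel h x.
Proof.
have [_ _ _ _ _ _ _ eP _ eAp eAm _ _ eA] := irrep_osp q0 q1 he mu0.
have opp_addr (U : zmodType) (a b c : U) : a + b = c -> b = c - a.
  by move=> <-; rewrite addrAC subrr add0r.
split.
- apply: endo_eq; pose e := @shift_rel_id R[i] nat kc kic kcK; exact e.
- have c n : kc n * kic n = 1 by rewrite mulrC.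
  apply: endo_eq; pose e := @shift_rel_id R[i] nat kic kc c; exact e.
- apply: endo_eq; exact: eP.
- have c n : kc n * pc n = 1 * (pc n * kc n) by rewrite mul1r mulrC.
  apply: endo_eq; pose e := @shift_rel R[i] RiC nat 1 pc kc kc pc id id id id
    (fun=> erefl) c.
  by apply: etrans e _; exact: scale1r.
- have c n : kic n * pc n = 1 * (pc n * kic n) by rewrite mul1r mulrC.
  apply: endo_eq; pose e := @shift_rel R[i] RiC nat 1 pc kic kic pc id id id id
    (fun=> erefl) c.
  by apply: etrans e _; exact: scale1r.
- have e : gAp x * gP x + gP x * gAp x = 0.
    by apply: endo_eq; rewrite endo_valD endo_val0; exact eAp.
  exact (esym (addr0_eq e)).
- have e : gAm x * gP x + gP x * gAm x = 0.
    by apply: endo_eq; rewrite endo_valD endo_val0; exact eAm.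
  exact (esym (addr0_eq e)).
- have c n : apc n * kc n.+1 = h * (kc n * apc n) by rewrite kcS mulrC mulrA.
  apply: endo_eq; pose e := @shift_rel R[i] RiC nat h kc apc apc kc id S S id
    (fun=> erefl) c.
  exact e.
- have c n : amc n * kc n.-1 = h^-1 * (kc n * amc n).
    (* At [n = 0] the predecessor is 0 by default, but the coefficient of [A-] vanishes there. *)
    by case: n => [|n]; rewrite ?amc0 ?mul0r ?mulr0 // (kcV n) mulrC mulrA.
  apply: endo_eq; pose e := @shift_rel R[i] RiC nat h^-1 kc amc amc kc id predn predn id
    (fun=> erefl) c.
  exact e.
- have c n : apc n * kic n.+1 = h^-1 * (kic n * apc n).
    by rewrite kicS mulrC mulrA.
  apply: endo_eq; pose e := @shift_rel R[i] RiC nat h^-1 kic apc apc kic id S S id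
    (fun=> erefl) c.
  exact e.
- have c n : amc n * kic n.-1 = h * (kic n * amc n).
    by case: n => [|n]; rewrite ?amc0 ?mul0r ?mulr0 // (kicV n) mulrC mulrA.
  apply: endo_eq; pose e := @shift_rel R[i] RiC nat h kic amc amc kic id predn predn id
    (fun=> erefl) c.
  exact e.
- have e : gAp x * gAm x + gAm x * gAp x =
      (h - h^-1)^-1 *: (gK x * gK x - gKi x * gKi x).
    apply: endo_eq; rewrite endo_valD endo_valZ endo_valD endo_valN.
    by rewrite -(qhalfE q0); exact eA.
  exact (opp_addr _ _ _ _ e).
Qed.

(** On the vector of index [n], [A+ A-] acts by [sigma_n] and the Cartan part by [[n + mu]_q]. Their
    difference is [-(-1)^n [mu]_q], and the sign is absorbed by [P]. *)
Lemma irrep_cas : cas h x = (- eps * qnum q mu)%:C%:A.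
Proof.
apply: endo_eq.
have c1 n : (amc n * apc n.-1) *: << n.-1.+1 >> = (sigma q mu n)%:C *: << n >>
    :> {malg R[i][nat]}.
  case: n => [|n] /=; first by rewrite amc0 mul0r sigma0 !scale0r.
  by rewrite /amc /apc -rmorphM -expr2 sqr_sqrtr // sigma_ge0.
have c2 n : pc n * ((sigma q mu n)%:C - ((h ^+ 2 - h ^- 2)^-1) *
    (h^-1 * (kc n * kc n) - h * (kic n * kic n))) = (- eps * qnum q mu)%:C.
  (* The half in [weight n] produces the factor [h], which the prefactor [h^-1] of [K^2] in the
     Casimir operator removes. *)
  have kk : kc n * kc n = h * qpow q (n%:R + mu).
    by rewrite /kc -!qpowD // -splitr; congr (qpow q _); exact: addrC.
  have kkV : kic n * kic n = h^-1 * qpow q (- (n%:R + mu)).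
    rewrite /kic -(qpowN q0) -!qpowD // -splitr; congr (qpow q _).
    by rewrite /weight opprD addrC.
  rewrite kk kkV mulKf // mulVKf // -(qdiffE q0) mulrC -rmorphB -rmorphM -rmorphB.
  rewrite mulrC -rmorphM; congr (_%:C).
  rewrite [_^-1 * _]mulrC -/(qnum q (n%:R + mu)) /sigma addrAC subrr add0r.
  have s1 : (-1) ^+ n * (-1) ^+ n = 1 :> R by rewrite -exprMn mulrNN mulr1 expr1n.
  by rewrite mulrN -mulrA (mulrA (_ ^+ n)) s1 mul1r mulNr.
pose e := @casimir_shift R[i] RiC nat (h ^+ 2 - h ^- 2)^-1 h^-1 h _ apc amc kc kic pc
  (fun n => (sigma q mu n)%:C) S predn c1 c2.
exact e.
Qed.
End Irreps.

(** * Even permutations of three indices *)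

Lemma ord3P (i : 'I_3) : [\/ i = ix1, i = ix2 | i = ix3].
Proof.
case: i => -[|[|[|//]]] lt.
- by apply: Or31; apply: val_inj.
- by apply: Or32; apply: val_inj.
- by apply: Or33; apply: val_inj.
Qed.

(** Injectivity leaves six triples of images; three of them are transpositions, which parity
    excludes. *)
Lemma even_perm3 (s : 'S_3) : ~~ odd_perm s ->
  [\/ [/\ s ix1 = ix1, s ix2 = ix2 & s ix3 = ix3],
      [/\ s ix1 = ix2, s ix2 = ix3 & s ix3 = ix1]
    | [/\ s ix1 = ix3, s ix2 = ix1 & s ix3 = ix2]].
Proof.
move=> even_s; have inj a b : s a = s b -> a = b by exact: perm_inj.
have not_tperm a b : a != b -> s <> tperm a b.
  by move=> ab st; move: even_s; rewrite st odd_tperm ab.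
have eq_tperm a b c : [\/ c = a, c = b | s c = c] -> s a = b -> s b = a ->
    s c = tperm a b c.
  move=> + sa sb; case=> [->|->|sc]; rewrite ?tpermL ?tpermR //.
  have [->|ca] := eqVneq c a; first by rewrite tpermL.
  have [->|cb] := eqVneq c b; first by rewrite tpermR.
  by rewrite tpermD 1?eq_sym.
case: (ord3P (s ix1)) => e1; case: (ord3P (s ix2)) => e2;
  case: (ord3P (s ix3)) => e3;
  try (by have := inj ix1 ix2 (etrans e1 (esym e2)));
  try (by have := inj ix1 ix3 (etrans e1 (esym e3)));
  try (by have := inj ix2 ix3 (etrans e2 (esym e3))).
- by apply: Or31.
- case: (not_tperm ix2 ix3 isT); apply/permP => c; apply: eq_tperm => //.
  by case: (ord3P c) => ->; [apply: Or33|apply: Or31|apply: Or32].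
- case: (not_tperm ix1 ix2 isT); apply/permP => c; apply: eq_tperm => //.
  by case: (ord3P c) => ->; [apply: Or31|apply: Or32|apply: Or33].
- by apply: Or32.
- by apply: Or33.
- case: (not_tperm ix1 ix3 isT); apply/permP => c; apply: eq_tperm => //.
  by case: (ord3P c) => ->; [apply: Or31|apply: Or33|apply: Or32].
Qed.

Lemma scaler_nest (K : nzRingType) (V : lmodType K) (a b c d e : K) (v : V) :
  c *: (a *: (b *: v) + d *: (e *: v)) = (c * (a * b + d * e)) *: v.
Proof. by rewrite !scalerA -scalerDl scalerA. Qed.

(** * Casimir operators of the triple tensor product *)

Section ThreeSites.
Context (R : realType) (q : R) (eps mu : 'I_3 -> R) (q0 : 0 < q) (q1 : q < 1).
Context (he : forall i, eps i = 1 \/ eps i = -1) (mu0 : forall i, 0 < mu i).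
Local Notation h := (qpow q 2^-1).
Local Notation E3 := (endo R (0%N, 0%N, 0%N)).

Definition site (i : 'I_3) : gens E3 :=
  gens_map (slot_endo i) (irrep_gens q (eps i) (mu i)).

Lemma site_osp i : osp_rel h (site i).
Proof. exact/osp_rel_map/irrep_gens_osp. Qed.

Lemma site_cas i : cas h (site i) = (tau_ q eps mu i)%:C%:A.
Proof.
rewrite /site cas_map irrep_cas //.
exact: rmorph_alg.
Qed.

Lemma site_represents i : represents (factor q eps mu i) (site i).
Proof. by []. Qed.

Lemma QoneE i : Qone q eps mu i = cas h (site i).
Proof.
rewrite /site cas_map /Qone.
have r : represents (irrep q (eps i) (mu i)) (irrep_gens q (eps i) (mu i)) by [].
by rewrite (casimirE q0 r).
Qed.

Lemma Qone_scalar i v : Qone q eps mu i v = (tau_ q eps mu i)%:C *: v.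
Proof. by rewrite QoneE site_cas. Qed.

Lemma Q12E : Q12 q eps mu = cas h (coprod (site ix1) (site ix2)).
Proof.
by apply: (casimirE q0); apply: comul_represents; exact: site_represents.
Qed.

Lemma Q23E : Q23 q eps mu = cas h (coprod (site ix2) (site ix3)).
Proof.
by apply: (casimirE q0); apply: comul_represents; exact: site_represents.
Qed.

Lemma QtotE :
  Qtot q eps mu = cas h (coprod (site ix1) (coprod (site ix2) (site ix3))).
Proof.
apply: (casimirE q0); apply: comul_represents; first exact: site_represents.
by apply: comul_represents; exact: site_represents.
Qed.

End ThreeSites.

(** * The cyclic relations for [I1], [I2], [I3] *)

Section BannaiIto.
Context (R : realType) (q : R) (eps mu : 'I_3 -> R) (q0 : 0 < q) (q1 : q < 1).
Context (he : forall i, eps i = 1 \/ eps i = -1) (mu0 : forall i, 0 < mu i).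
Local Notation h := (qpow q 2^-1).
Local Notation E3 := (endo R (0%N, 0%N, 0%N)).
Local Notation x := (site q eps mu).
Local Notation c := (qpow q 2^-1 + qpow q (- 2^-1)).

Lemma qc_half : c = qc h.
Proof. by rewrite /qc (qpowN q0). Qed.

Lemma qacomm_endo (f g : E3) : qacomm q f g = h *: (f * g) + h^-1 *: (g * f).
Proof. by rewrite /qacomm (qpowN q0). Qed.

Lemma qacomm_endo_combine (a : R[i]) (f g p k l m n : E3) :
  h *: (f * g) + h^-1 *: (g * f) = p + a *: (k * l + m * n) ->
  qacomm q f g =
  endo_val p + a *: ((endo_val k \o endo_val l) + (endo_val m \o endo_val n)).
Proof. by move=> e; rewrite qacomm_endo e. Qed.

Lemma endo_val_combineN (a : R[i]) (f k l m n : E3) :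
  endo_val (f - a *: (k * l + m * n)) =
  endo_val f - a *: ((endo_val k \o endo_val l) + (endo_val m \o endo_val n)).
Proof. by []. Qed.

(** [Q] and the following [J1], [J3], [J2] are [Qtot], [I1], [I3], [I2] as elements of the algebra
    [E3], where the abstract relations apply. *)
Let Q : E3 := cas h (coprod (x ix1) (coprod (x ix2) (x ix3))).
Let J1 : E3 := - cas h (coprod (x ix2) (x ix3)).
Let J3 : E3 := - cas h (coprod (x ix1) (x ix2)).
Let J2 : E3 := h *: (J3 * J1) + h^-1 *: (J1 * J3)
  - qc h *: (cas h (x ix3) * cas h (x ix1) + cas h (x ix2) * Q).

Lemma I1E : I1 q eps mu = J1. Proof. by rewrite /I1 (Q23E eps mu q0). Qed.
Lemma I3E : I3 q eps mu = J3. Proof. by rewrite /I3 (Q12E eps mu q0). Qed.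
Lemma I2E : I2 q eps mu = J2.
Proof.
rewrite /I2 I3E I1E qacomm_endo qc_half !(QoneE eps mu q0) (QtotE eps mu q0).
exact: esym (endo_val_combineN _ _ _ _ _ _).
Qed.

Lemma site_relations :
  h *: (J1 * J2) + h^-1 *: (J2 * J1) =
    J3 + qc h *: (cas h (x ix1) * cas h (x ix2) + cas h (x ix3) * Q)
  /\ h *: (J2 * J3) + h^-1 *: (J3 * J2) =
    J1 + qc h *: (cas h (x ix2) * cas h (x ix3) + cas h (x ix1) * Q).
Proof.
have o i : osp_rel h (x i) by exact: site_osp.
have s i : cas h (x i) = (tau_ q eps mu i)%:C%:A by exact: site_cas.
have k (i j : 'I_3) : (i < j)%N -> commuting (x i) (x j) by exact: slot_commuting.
have [h0 h1] := (qpow_neq0 q0 2^-1, qpow_half_neq1 q0 q1).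
have k12 := k ix1 ix2 isT; have k13 := k ix1 ix3 isT; have k23 := k ix2 ix3 isT.
exact (bannai_ito_three_sites h0 h1 (o ix1) (o ix2) (o ix3) k12 k13 k23
  (s ix1) (s ix2) (s ix3)).
Qed.

Lemma qacomm_cyclic (i j k : 'I_3) :
  [\/ [/\ i = ix1, j = ix2 & k = ix3], [/\ i = ix2, j = ix3 & k = ix1]
    | [/\ i = ix3, j = ix1 & k = ix2]] ->
  qacomm q (Iop q eps mu i) (Iop q eps mu j) =
    Iop q eps mu k + c *: ((Qone q eps mu i \o Qone q eps mu j)
                           + (Qone q eps mu k \o Qtot q eps mu)).
Proof.
have [e12 e23] := site_relations.
case=> -[-> -> ->]; rewrite /Iop /=.
- rewrite I1E I2E I3E qc_half !(QoneE eps mu q0) (QtotE eps mu q0).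
  exact (qacomm_endo_combine e12).
- rewrite I1E I2E I3E qc_half !(QoneE eps mu q0) (QtotE eps mu q0).
  exact (qacomm_endo_combine e23).
(* The relation for [I3] and [I1] is the definition of [I2]. *)
- by rewrite /I2 subrK.
Qed.
End BannaiIto.

Theorem mainTheorem1 (R : realType) (q : R) (eps mu : 'I_3 -> R)
    (hq0 : 0 < q) (hq1 : q < 1)
    (heps : forall i : 'I_3, eps i = 1 \/ eps i = -1)
    (hmu : forall i : 'I_3, 0 < mu i) :
  (forall (s : 'S_3) (i j k : 'I_3), ~~ odd_perm s ->
     i = s ix1 -> j = s ix2 -> k = s ix3 ->
     qacomm q (Iop q eps mu i) (Iop q eps mu j) =
       Iop q eps mu k
       + (qpow q 2^-1 + qpow q (- 2^-1)) *:
           ((Qone q eps mu i \o Qone q eps mu j)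
            + (Qone q eps mu k \o Qtot q eps mu)))
  /\
  (forall (tau : R[i]) (v : W3 R), Qtot q eps mu v = tau *: v ->
     forall (s : 'S_3) (i j k : 'I_3), ~~ odd_perm s ->
     i = s ix1 -> j = s ix2 -> k = s ix3 ->
     let iota_k : R[i] :=
       (qpow q 2^-1 + qpow q (- 2^-1)) *
         (tau * (tau_ q eps mu k)%:C
          + (tau_ q eps mu i)%:C * (tau_ q eps mu j)%:C) in
     qacomm q (Iop q eps mu i) (Iop q eps mu j) v =
       Iop q eps mu k v + iota_k *: v).
Proof.
have main (s : 'S_3) (i j k : 'I_3) : ~~ odd_perm s ->
    i = s ix1 -> j = s ix2 -> k = s ix3 ->
    qacomm q (Iop q eps mu i) (Iop q eps mu j) =
      Iop q eps mu k
      + (qpow q 2^-1 + qpow q (- 2^-1)) *: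
          ((Qone q eps mu i \o Qone q eps mu j)
           + (Qone q eps mu k \o Qtot q eps mu)).
  by move=> /even_perm3 es -> -> ->; exact: qacomm_cyclic.
split; first exact main.
move=> tau v Qv s i j k es si sj sk iota_k.
rewrite (main s i j k es si sj sk).
(* The one-site Casimir operators are scalar on the whole space, so evaluating the operator identity
   at the eigenvector [v] turns the bracket into a scalar. *)
have Qs l w : Qone q eps mu l w = (tau_ q eps mu l)%:C *: w.
  exact: Qone_scalar.
rewrite -[LHS]/(Iop q eps mu k v + (qpow q 2^-1 + qpow q (- 2^-1)) *:
  (Qone q eps mu i (Qone q eps mu j v) + Qone q eps mu k (Qtot q eps mu v))).
rewrite Qv !Qs scaler_nest; congr (_ + _ *: v); congr (_ * _).
by rewrite addrC [tau * _]mulrC.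
Qed.
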